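(* Let $f\in\mathcal H_0$, that is, $f=\mathcal B[\varphi]$ for some $\varphi\in L_2(m)$. Then $$\mathcal P f=\mathcal B\big[(M+(1-M)\mathcal K)\varphi\big],$$ and, for every $\lambda\in\mathbb C\setminus[0,1]$ such that $1$ is not an eigenvalue of $\mathcal K_{1/\lambda}:L_2(m)\to L_2(m)$, $$(\lambda-\mathcal P)^{-1}f=\mathcal B\big[(1-\mathcal K_{1/\lambda})^{-1}(\lambda-M)^{-1}\varphi\big].$$
   Context: Let $m$ be the measure on $\mathbb R^+=(0,\infty)$ given by $dm(t)=\frac{t}{e^t-1}\,dt$, and $L_2(m)$ the complex Hilbert space of square-integrable functions. $\mathcal H_0$ is the Hilbert space of all functions of the form $$f(w)=(\mathcal B[\varphi])(w):=\frac1{w^2}\int_0^\infty e^{-t/w}\,e^t\,\varphi(t)\,dm(t),\qquad \varphi\in L_2(m),$$ which are holomorphic in the disk $D_1=\{w\in\mathbb C:\operatorname{Re}(1/w)>1/2\}=\{|w-1|<1\}$, with inner product $(\mathcal B[\varphi_1],\mathcal B[\varphi_2])=\int_0^\infty\overline{\varphi_1}\,\varphi_2\,dm$. $\mathcal P$ is the transfer operator of the Farey map ($F(x)=x/(1-x)$ for $0\le x\le 1/2$, $F(x)=(1-x)/x$ for $1/2<x\le1$), acting on $\mathcal H_0$ by $$(\mathcal P f)(w)=\Big(\frac1{w+1}\Big)^2\Big[f\Big(\frac w{w+1}\Big)+f\Big(\frac1{w+1}\Big)\Big].$$ $M:L_2(m)\to L_2(m)$ is multiplication by $e^{-t}$: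 $(M\varphi)(t)=e^{-t}\varphi(t)$. $\mathcal K:L_2(m)\to L_2(m)$ is the integral operator $(\mathcal K\varphi)(t)=\int_0^\infty\frac{J_1(2\sqrt{st})}{\sqrt{st}}\varphi(s)\,dm(s)$, where $J_1$ is the Bessel function of the first kind of order $1$. For $z\in\mathbb C\setminus(1,\infty)$, $\mathcal K_z:=z(1-M)(1-zM)^{-1}\mathcal K$, i.e. $(\mathcal K_z\varphi)(t)=\frac{z(1-e^{-t})}{1-ze^{-t}}(\mathcal K\varphi)(t)$. *)

(* Defs.v *)
(* MathComp-Analysis, complex numbers over a realType R being R[i]. *)
From HB Require Import structures.
From mathcomp Require Import all_boot all_order all_algebra.
From mathcomp Require Import all_classical all_reals all_analysis.
From mathcomp Require Import measurable_realfun.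
From mathcomp Require Import complex.

Set Implicit Arguments.
Unset Strict Implicit.
Unset Printing Implicit Defensive.

Import Order.TTheory GRing.Theory Num.Theory.
Import numFieldNormedType.Exports.

Local Open Scope classical_set_scope.
Local Open Scope ring_scope.
Local Open Scope complex_scope.

Section Measure.
Variable R : realType.

Definition Rpos : set R := `]0, +oo[.

Definition m_density (t : R) : R := t / (expR t - 1).

(* As a set function on the Borel sets of R; it charges only Rpos. *)
Definition m_meas (A : set (measurableTypeR R)) : \bar R :=
  (\int[lebesgue_measure]_(t in A) ((m_density \_ Rpos) t)%:E)%E.

Lemma m_density_ge0 (t : R) : 0 <= (m_density \_ Rpos) t.
Proof.
apply: restrict_ge0 => {}t; rewrite /Rpos/= in_itv/= andbT => t0.
by rewrite /m_density divr_ge0 ?subr_ge0 ?ltW ?expR_gt1.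
Qed.

Lemma measurable_m_density : measurable_fun [set: R] (m_density \_ Rpos).
Proof.
apply/measurable_restrict => //=; first exact: measurable_itv.
rewrite setTI /Rpos /m_density.
apply: open_continuous_measurable_fun; first exact: interval_open.
move=> t /set_mem /=.
rewrite in_itv/= andbT => t0.
apply: (@continuousM _ R^o (fun t : R => t) (fun t => (expR t - 1)^-1)) => //.
apply: continuousV; first by rewrite subr_eq0 gt_eqF// expR_gt1.
apply: (@continuousB _ R^o); first exact: continuous_expR.
exact: cst_continuous.
Qed.

Let m_meas0 : m_meas set0 = 0%E.
Proof. by rewrite /m_meas integral_set0. Qed.

Let m_meas_ge0 A : (0 <= m_meas A)%E.
Proof. by apply: integral_ge0 => t _; rewrite lee_fin m_density_ge0. Qed.

Let m_meas_sigma_additive : semi_sigma_additive m_meas.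
Proof.
move=> /= A mA tA mUA; rewrite /m_meas ge0_integral_bigcup//=.
- apply: is_cvg_ereal_nneg_natsum_cond => n _ _.
  by apply: integral_ge0 => t _; rewrite lee_fin m_density_ge0.
- apply: measurable_funTS; apply/measurable_EFinP.
  exact: measurable_m_density.
- by move=> t _; rewrite lee_fin m_density_ge0.
Qed.

HB.instance Definition _ := isMeasure.Build _ _ _
  m_meas m_meas0 m_meas_ge0 m_meas_sigma_additive.

End Measure.

Section Operators.
Variable R : realType.
Local Notation C := R[i].
Local Notation Rpos := (@Rpos R).
Local Notation m := (@m_meas R).

Definition Cintegral_m (F : R -> C) : C :=
  (\int[m]_(t in Rpos) complex.Re (F t))%R
    +i* (\int[m]_(t in Rpos) complex.Im (F t))%R.

Definition Cexp (z : C) : C :=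
  (expR (complex.Re z))%:C * (cos (complex.Im z) +i* sin (complex.Im z)).

(* The Bessel function of the first kind of integer order n. *)
Definition besselJ (n : nat) (x : R) : R :=
  limn (series (fun k : nat =>
    (-1) ^+ k / (k`! * (k + n)`!)%:R * (x / 2) ^+ (2 * k + n))).

(* Representatives of the classes of the complex Hilbert space L_2(m); the
   values outside (0, oo) are irrelevant, and L2_eq is equality in L_2(m). *)
Definition L2 (phi : R -> C) : Prop :=
  [/\ measurable_fun Rpos (fun t => complex.Re (phi t)),
      measurable_fun Rpos (fun t => complex.Im (phi t)) &
      (\int[m]_(t in Rpos)
         (complex.Re (phi t) ^+ 2 + complex.Im (phi t) ^+ 2)%:E < +oo)%E].

Definition L2_eq (phi psi : R -> C) : Prop :=
  {ae m, forall t, Rpos t -> phi t = psi t}.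

Definition D1 : set C := [set w | 1 / 2 < complex.Re (w^-1)].

Definition opB (phi : R -> C) (w : C) : C :=
  w ^- 2 * Cintegral_m (fun t =>
    Cexp (- (t%:C / w)) * (expR t)%:C * phi t).

(* Functions on D_1 are represented by total functions, compared on D_1. *)
Definition D1_eq (f g : C -> C) : Prop := forall w, D1 w -> f w = g w.

Definition calH0 (f : C -> C) : Prop := exists2 phi, L2 phi & D1_eq f (opB phi).

Definition opP (f : C -> C) (w : C) : C :=
  (1 / (w + 1)) ^+ 2 * (f (w / (w + 1)) + f (1 / (w + 1))).

Definition opM (phi : R -> C) (t : R) : C := (expR (- t))%:C * phi t.

Definition opK (phi : R -> C) (t : R) : C :=
  Cintegral_m (fun s =>
    (besselJ 1 (2 * Num.sqrt (s * t)) / Num.sqrt (s * t))%:C * phi s).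

Definition opKz (z : C) (phi : R -> C) (t : R) : C :=
  z * (1 - (expR (- t))%:C) / (1 - z * (expR (- t))%:C) * opK phi t.

(* The operator c - T. *)
Definition op_scalar_minus (U : Type) (c : C) (T : (U -> C) -> U -> C)
    (f : U -> C) (x : U) : C := c * f x - T f x.

(* Below, a linear space of functions is given by a set S of representatives
   and the equality E of the elements that they represent. *)
Definition op_eigenvalue (U : Type) (S : (U -> C) -> Prop)
    (E : (U -> C) -> (U -> C) -> Prop) (T : (U -> C) -> U -> C) (c : C) :=
  exists f, [/\ S f, ~ E f (fun=> 0) & E (T f) (fun x => c * f x)].

(* T induces a bijection of S/E onto itself. *)
Definition op_invertible (U : Type) (S : (U -> C) -> Prop)
    (E : (U -> C) -> (U -> C) -> Prop) (T : (U -> C) -> U -> C) :=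
  [/\ forall f, S f -> S (T f),
      forall f g, S f -> S g -> (E f g <-> E (T f) (T g)) &
      forall g, S g -> exists2 f, S f & E (T f) g].

(* A representative of T^-1 g, determined up to E when T is invertible. *)
Definition op_inverse (U : Type) (S : (U -> C) -> Prop)
    (E : (U -> C) -> (U -> C) -> Prop) (T : (U -> C) -> U -> C)
    (g : U -> C) : U -> C :=
  xget (fun=> 0) [set f | S f /\ E (T f) g].

End Operators.

(* Main.v *)
Require Import Defs.
From HB Require Import structures.
From mathcomp Require Import all_boot all_order all_algebra.
From mathcomp Require Import all_classical all_reals all_analysis.
From mathcomp Require Import measurable_realfun.
From mathcomp Require Import complex ring lra.

(** With [g u = \sum_k (-u)^k / (k! (k+1)!)] the kernel of [K] is
    [J_1 (2 sqrt (st)) / sqrt (st) = g (st)]. The equation [u g'' + 2 g' + g = 0]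
    makes the energy [g^2 + u g'^2] decreasing, so [|g| <= 1] on the half-line;
    as [m] is finite, [K] maps [L_2(m)] into bounded functions.

    The identity [P B = B (M + (1 - M) K)] comes down, by Fubini, to the Laplace
    transform [\int_0^oo t e^(-pt) g (st) dt = p^-2 e^(-s/p)] for complex [p];
    its left-hand side solves [p y' + y = 0] in [s], which is seen by
    differentiating under the integral and integrating by parts.

    Since [lam - M - (1 - M) K = (lam - M) (1 - K_(1/lam))], the rest follows from
    the injectivity of [B] and the bijectivity of [1 - K_(1/lam)].
    The former is Lerch's theorem: the moments of [e^(-t)] vanish, and the
    polynomials [(1 - x^n)^N] in [x = e^(-t)], with [N ~ n e^(na)], converge
    boundedly to the indicator of [t > a]. The latter is a Fredholm alternative:
    after truncation and Taylor expansion of [g], [K_(1/lam)] is a finite-rank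
    operator plus a contraction for the sup norm with weight [e^(t/8)], a norm
    which dominates that of [L_2(m)] and in which Neumann series converge
    pointwise. *)

Set Implicit Arguments.
Unset Strict Implicit.
Unset Printing Implicit Defensive.

Import Order.TTheory GRing.Theory Num.Theory.
Import numFieldNormedType.Exports.

Local Open Scope classical_set_scope.
Local Open Scope ring_scope.
Local Open Scope complex_scope.

(** * Integration against m on the half-line *)

(** All exponents go back to one threshold: e^(ct) is m-integrable for c < 1, hence in L_2(m) for c
    < 1/2. This is why the integral defining B converges for Re (1/w) > 1/2, and it leaves room for
    the weights of the Fredholm part. There e^(t/8) must lie in L_2(m), and it must grow in order to
    absorb the kernel of K at large t, where Taylor polynomials give no control; the gap between
    e^(s/8) and the m-integrable e^(s/4) plays the same role at large s. A function of L_2(m) need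
    not obey a weighted bound, but K sends it to a bounded function. So the equation (1 - K_(1/lam))
    phi = psi is solved for the correction phi - psi, which does live in the weighted space. The
    Laplace transform is studied for s > - Re p / 4, so that s = 0, where its value is computed
    directly, is an interior point of the differential equation. Complex integrals are
    componentwise, so complex identities appear as pairs of real ones. *)

Section IntegrationOnRpos.
Context {R : realType} (mu : {measure set (measurableTypeR R) -> \bar R}).
Local Notation D := (@Rpos R).
Local Notation integ f := (mu.-integrable D (EFin \o f)).
Local Notation I f := (\int[mu]_(t in D) f t)%R.
Implicit Types f g : R -> R.

Lemma RposE (t : R) : D t = (0 < t) :> Prop.
Proof. by rewrite /Rpos/= in_itv/= andbT. Qed.

Lemma measurable_Rpos : measurable (D : set (measurableTypeR R)).
Proof. exact: measurable_itv. Qed.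

Lemma integ_ext f g : (forall t, 0 < t -> f t = g t) -> integ f -> integ g.
Proof.
move=> fg; apply: (eq_integrable measurable_Rpos).
by move=> t /[!inE]; rewrite RposE => /fg /= ->.
Qed.

Lemma integ_meas f : integ f -> measurable_fun D f.
Proof. by move=> /measurable_int /measurable_EFinP. Qed.

Lemma integ_dom f g : measurable_fun D f ->
  (forall t, 0 < t -> `|f t| <= g t) -> integ g -> integ f.
Proof.
move=> mf fg; apply: (le_integrable measurable_Rpos); first exact/measurable_EFinP.
move=> t; rewrite RposE => t0 /=; rewrite lee_fin.
by apply: le_trans (fg _ t0) _; exact: ler_norm.
Qed.

Lemma integZ (k : R) f : integ f -> integ (fun t => k * f t).
Proof. exact: (integrableZl measurable_Rpos). Qed.

Lemma integD f g : integ f -> integ g -> integ (fun t => f t + g t).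
Proof. exact: (integrableD measurable_Rpos). Qed.

Lemma integB f g : integ f -> integ g -> integ (fun t => f t - g t).
Proof. exact: (integrableB measurable_Rpos). Qed.

Lemma integ_norm f : integ f -> integ (fun t => `|f t|).
Proof. exact: integrable_norm. Qed.

Lemma eq_Rint f g : (forall t, 0 < t -> f t = g t) -> I f = I g.
Proof.
by move=> fg; apply: eq_Rintegral => t /[!inE]; rewrite RposE => /fg.
Qed.

Lemma RintD f g : integ f -> integ g -> I (fun t => f t + g t) = I f + I g.
Proof. exact: (RintegralD measurable_Rpos). Qed.

Lemma RintB f g : integ f -> integ g -> I (fun t => f t - g t) = I f - I g.
Proof. exact: (RintegralB measurable_Rpos). Qed.

Lemma RintZ (k : R) f : integ f -> I (fun t => k * f t) = k * I f.
Proof. exact: (RintegralZl _ measurable_Rpos). Qed.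

Lemma Rint_ge0 f : (forall t, 0 < t -> 0 <= f t) -> 0 <= I f.
Proof. by move=> f0; apply: Rintegral_ge0 => t; rewrite RposE; exact: f0. Qed.

Lemma Rint_le f g : integ f -> integ g ->
  (forall t, 0 < t -> f t <= g t) -> I f <= I g.
Proof.
move=> hf hg fg; apply: (le_Rintegral measurable_Rpos) => // t.
by rewrite RposE; exact: fg.
Qed.

Lemma Rint_norm_le f g : integ f -> integ g ->
  (forall t, 0 < t -> `|f t| <= g t) -> `|I f| <= I g.
Proof.
move=> hf hg fg; apply: le_trans (le_normr_Rintegral measurable_Rpos hf) _.
by apply: Rint_le => //; exact: integ_norm.
Qed.

Lemma integ_mulb f g (C : R) : integ f -> measurable_fun D g ->
  (forall t, 0 < t -> `|g t| <= C) -> integ (fun t => g t * f t).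
Proof.
move=> hf mg gC; apply: (@integ_dom _ (fun t => C * `|f t|)).
- by apply: measurable_funM => //; exact: integ_meas.
- by move=> t t0; rewrite normrM ler_wpM2r ?gC.
- exact/integZ/integ_norm.
Qed.

Lemma Rint_dominated (F : nat -> R -> R) f g :
  (forall n, measurable_fun D (F n)) -> measurable_fun D f -> integ g ->
  (forall t, 0 < t -> F n t @[n --> \oo] --> f t) ->
  (forall n t, 0 < t -> `|F n t| <= g t) ->
  I (F n) @[n --> \oo] --> I f.
Proof.
move=> mF mf hg Ff Fg.
have h : {ae mu, forall x, D x -> (EFin \o F n) x @[n --> \oo] --> (EFin \o f) x}.
  apply: aeW => x; rewrite RposE => x0; apply/fine_cvgP; split => /=.
    exact: nearW.
  exact: Ff.
have hb : {ae mu, forall x n, D x -> (`|(EFin \o F n) x| <= (EFin \o g) x)%E}.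
  by apply: aeW => x n; rewrite RposE => x0 /=; rewrite lee_fin Fg.
have [intf _ cv] := dominated_convergence measurable_Rpos
  (fun n => iffRL (measurable_EFinP _ _) (mF n))
  (iffRL (measurable_EFinP _ _) mf) h hg hb.
move: cv; rewrite -[X in _ --> X]fineK; last first.
  exact: (integrable_fin_num measurable_Rpos intf).
by move=> /fine_cvgP[_].
Qed.
End IntegrationOnRpos.

(** * Exponential bounds on the density and finiteness of m *)

Section FareyMeasure.
Context {R : realType}.
Local Notation mu := (@lebesgue_measure R).
Local Notation D := (@Rpos R).
Local Notation m := (@m_meas R).

Lemma integrable_expN (a : R) : 0 < a ->
  mu.-integrable D (EFin \o (fun t => expR (- (a * t)))).
Proof.
move=> a0.
have h := integrable_exponential_pdf a0.
have {}h := integrableS measurableT measurable_Rpos (@subsetT _ _) h.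
apply: integ_ext (integZ a^-1 h) => t t0 /=.
by rewrite exponential_pdfE ?ltW// mulKf ?gt_eqF// mulNr.
Qed.

Lemma le_add1_expR (d t : R) : 0 < d <= 1 -> 0 <= t -> 1 + t <= d^-1 * expR (d * t).
Proof.
move=> /andP[d0 d1] t0; rewrite -ler_pdivrMl ?invr_gt0// invrK.
by apply: le_trans (expR_ge1Dx _); rewrite mulrDr mulr1 lerD2r.
Qed.

(** After multiplication by e^t - 1 this is (1 + t) e^(-t) <= 1, which follows from 1 + t <= e^t. *)
Lemma m_density_le (t : R) : 0 < t -> m_density t <= (1 + t) * expR (- t).
Proof.
move=> t0; rewrite /m_density ler_pdivrMr ?subr_gt0 ?expR_gt1//.
rewrite -mulrA mulrBr mulr1 expRN mulVf ?gt_eqF ?expR_gt0//.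
have : (expR t)^-1 <= (1 + t)^-1.
  by rewrite lef_pV2 ?posrE ?expR_gt0 ?addr_gt0// expR_ge1Dx.
move=> h; have := ler_wpM2l (ltW (addr_gt0 ltr01 t0)) h.
rewrite mulfV ?gt_eqF ?addr_gt0// => {}h.
by rewrite mulrBr mulr1; lra.
Qed.

(** The factor 1 + t of [m_density_le] costs an arbitrarily small rate d, so the density behaves
    like e^(-t) for integrability purposes. *)
Lemma m_density_exp (c d t : R) : 0 < d <= 1 -> 0 < t ->
  expR (c * t) * m_density t <= d^-1 * expR (- ((1 - c - d) * t)).
Proof.
move=> d1 t0.
apply: (@le_trans _ _ (expR (c * t) * ((1 + t) * expR (- t)))).
  by rewrite ler_wpM2l ?expR_ge0 ?m_density_le.
apply: (@le_trans _ _ (expR (c * t) * ((d^-1 * expR (d * t)) * expR (- t)))).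
  rewrite ler_wpM2l ?expR_ge0// ler_wpM2r ?expR_ge0// le_add1_expR//.
  exact: ltW.
rewrite -mulrA mulrCA -!expRD ler_wpM2l ?invr_ge0 ?(ltW (andP d1).1)//.
by rewrite ler_expR; lra.
Qed.

Lemma m_density_pos (t : R) : 0 < t -> 0 <= m_density t.
Proof. by move=> t0; rewrite /m_density divr_ge0 ?subr_ge0 ?ltW ?expR_gt1. Qed.

Lemma m_density_restr (t : R) : 0 < t -> (@m_density R \_ D) t = m_density t.
Proof. by move=> t0; rewrite patchE mem_set// RposE. Qed.

Lemma measurable_density : measurable_fun D (@m_density R).
Proof.
have /(measurable_funS measurableT (@subsetT _ D)) := @measurable_m_density R.
apply: eq_measurable_fun => t /[!inE]; rewrite RposE => t0.
by rewrite m_density_restr.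
Qed.

Lemma integrable_density : mu.-integrable [set: R] (fun t => ((@m_density R \_ D) t)%:E).
Proof.
suff : mu.-integrable [set: R] ((EFin \o @m_density R) \_ D).
  apply: eq_integrable => // t _; rewrite !patchE.
  by case: ifPn.
apply/(integrable_mkcond _ measurable_Rpos).
apply: integ_dom (integZ 2 (integrable_expN (a := 2^-1) ltac:(lra))).
  exact: measurable_density.
move=> t t0; rewrite ger0_norm ?m_density_pos//.
have := @m_density_exp 0 2^-1 t ltac:(lra) t0.
by rewrite mul0r expR0 mul1r invrK subr0 (_ : 1 - 2^-1 = 2^-1)//; lra.
Qed.

(** Finiteness brings m within reach of the Radon-Nikodym and Fubini theorems and makes bounded
    measurable functions integrable. *)
Lemma m_meas_setT_lty : (m [set: R] < +oo)%E.
Proof.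
have /integrableP[_] := integrable_density; apply: le_lt_trans.
rewrite /m_meas; apply: ge0_le_integral => //=.
- by move=> t _; rewrite lee_fin m_density_ge0.
- by apply/measurable_EFinP; exact: measurable_m_density.
- by do 2 apply: measurableT_comp => //; exact: measurable_m_density.
- by move=> t _; rewrite lee_fin ler_norm.
Qed.

HB.instance Definition _ := Measure_isFinite.Build _ _ _ m
  (lty_fin_num_fun m_meas_setT_lty).
End FareyMeasure.

(** * Passage between m and Lebesgue measure *)

Section FareyMeasureDensity.
Context {R : realType}.
Local Notation mu := (@lebesgue_measure R).
Local Notation D := (@Rpos R).
Local Notation m := (@m_meas R).
Local Notation rho := (@m_density R).

Lemma m_meas_dominates : (m : set (measurableTypeR R) -> \bar R) `<< mu.
Proof.
apply/null_content_dominatesP => A mA A0.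
rewrite /m_meas null_set_integral//.
apply/measurable_EFinP; apply: measurable_funTS.
exact: measurable_m_density.
Qed.

Local Notation RN := (Radon_Nikodym_SigmaFinite.f m mu).

(** Densities are unique: both functions integrate to m(E) over every Borel set E. The change of
    variables for Radon-Nikodym derivatives thus becomes usable with the explicit density. *)
Lemma ae_RN : ae_eq mu [set: measurableTypeR R] (fun t => ((rho \_ D) t)%:E) RN.
Proof.
apply: integral_ae_eq => //.
- exact: integrable_density.
- apply: measurable_int; exact: (Radon_Nikodym_SigmaFinite.f_integrable m_meas_dominates).
- move=> E _ mE; rewrite -Radon_Nikodym_SigmaFinite.f_integral//.
  exact: m_meas_dominates.
Qed.

Lemma measurable_RN (E : set (measurableTypeR R)) : measurable_fun E RN.
Proof.
apply: measurable_funTS; apply: measurable_int.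
exact: (Radon_Nikodym_SigmaFinite.f_integrable m_meas_dominates).
Qed.

Lemma integral_m_ge0 (f : R -> R) : measurable_fun D f ->
  (forall t, 0 < t -> 0 <= f t) ->
  (\int[m]_(t in D) (f t)%:E = \int[mu]_(t in D) (f t * rho t)%:E)%E.
Proof.
move=> mf f0.
(* The sign of [f] is known on the half-line only; its absolute value is nonnegative everywhere, so
   the change of variables applies to it. *)
transitivity (\int[m]_(t in D) (`|f t|)%:E)%E.
  apply: eq_integral => t /[!inE]; rewrite RposE => t0.
  by rewrite ger0_norm ?f0.
have mnf : measurable_fun D (fun t => (`|f t|)%:E).
  by apply/measurable_EFinP; exact: measurableT_comp.
rewrite -(Radon_Nikodym_SigmaFinite.change_of_variables m_meas_dominates)//;
  last exact: measurable_Rpos.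
apply: ae_eq_integral.
- exact: measurable_Rpos.
- by apply: emeasurable_funM => //; exact: measurable_RN.
- by apply/measurable_EFinP/measurable_funM => //; exact: measurable_density.
have := ae_RN; apply: filterS => t /(_ I) h; rewrite RposE => t0.
by rewrite -h m_density_restr// EFinM ger0_norm ?f0.
Qed.

Lemma integ_m (f : R -> R) : measurable_fun D f ->
  mu.-integrable D (EFin \o (fun t => f t * rho t)) ->
  m.-integrable D (EFin \o f).
Proof.
move=> mf /integrableP[_ h]; apply/integrableP; split; first exact/measurable_EFinP.
rewrite (eq_integral (fun t : measurableTypeR R => (`|f t|)%:E)); last by move=> t _.
rewrite integral_m_ge0//; last exact: measurableT_comp.
move: h; rewrite (eq_integral (fun t : measurableTypeR R => (`|f t| * rho t)%:E))// => t /[!inE].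
by rewrite RposE => t0 /=; rewrite normrM (ger0_norm (m_density_pos t0)).
Qed.

Lemma Rint_m (f : R -> R) : m.-integrable D (EFin \o f) ->
  (\int[m]_(t in D) f t = \int[mu]_(t in D) (f t * rho t))%R.
Proof.
move=> hf; rewrite /Rintegral; congr fine.
rewrite -(Radon_Nikodym_change_of_variables m_meas_dominates measurable_Rpos hf).
have mf := measurable_int _ hf.
apply: ae_eq_integral.
- exact: measurable_Rpos.
- apply: emeasurable_funM => //; apply: measurable_funTS.
  apply: (measurable_int mu); apply: Radon_Nikodym_integrable.
  exact: m_meas_dominates.
- apply/measurable_EFinP/measurable_funM; first exact/measurable_EFinP.
  exact: measurable_density.
have h1 := ae_RN.
have h2 := ae_eq_Radon_Nikodym_SigmaFinite m_meas_dominates (@measurableT _ (measurableTypeR R)).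
apply: filterS2 h1 h2 => t /(_ I) h1 /(_ I) h2; rewrite RposE => t0.
by rewrite -h2 -h1 m_density_restr.
Qed.

Lemma measurable_expR_lin (c : R) : measurable_fun D (fun t : R => expR (c * t)).
Proof.
by apply: measurable_funTS; apply: measurableT_comp => //; exact: mulrl_measurable.
Qed.

Lemma integ_m_expR (c : R) : c < 1 -> m.-integrable D (EFin \o (fun t => expR (c * t))).
Proof.
move=> c1; apply: integ_m; first exact: measurable_expR_lin.
(* Half of the margin 1 - c pays for the linear factor of the density; [m_density_exp] asks for d <=
   1. *)
pose d := Num.min ((1 - c) / 2) 1.
have d1 : 0 < d <= 1.
  by rewrite /d lt_min ge_min lexx orbT andbT ltr01 andbT divr_gt0// subr_gt0.
have cd : 0 < 1 - c - d.
  have : d <= (1 - c) / 2 by rewrite /d ge_min lexx.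
  lra.
apply: integ_dom (integZ d^-1 (integrable_expN cd)).
  by apply: measurable_funM; [exact: measurable_expR_lin|exact: measurable_density].
move=> t t0; rewrite (ger0_norm (mulr_ge0 (expR_ge0 _) (m_density_pos t0))).
exact: m_density_exp.
Qed.

Lemma integ_m_cst (k : R) : m.-integrable D (EFin \o (fun=> k)).
Proof. by apply: finite_measure_integrable_cst; exact: measurable_Rpos. Qed.

End FareyMeasureDensity.

(** * The Bessel kernel *)

Section Bessel.
Context {R : realType}.

(* [besselg n u = J_n (2 sqrt u) / u ^ (n / 2)] *)
Definition besselc (n k : nat) : R := (-1) ^+ k / (k`! * (k + n)`!)%:R.
Definition besselg (n : nat) (u : R) : R := limn (pseries (besselc n) u).

Lemma besselc_le n k : `|besselc n k| <= (k`!%:R)^-1.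
Proof.
rewrite /besselc normrM normrX normrN1 expr1n mul1r ger0_norm//.
by rewrite lef_pV2 ?posrE ?ltr0n ?muln_gt0 ?fact_gt0// ler_nat leq_pmulr ?fact_gt0.
Qed.

Lemma is_cvg_besselg n u : cvgn (pseries (besselc n) u).
Proof.
apply: normed_cvg.
apply: (@series_le_cvg _ _ (exp_coeff `|u|)) => //=.
- by move=> k; rewrite exp_coeff_ge0.
- move=> k; rewrite /exp_coeff normrM normrX mulrC ler_wpM2l ?exprn_ge0//.
  exact: besselc_le.
- exact: is_cvg_series_exp_coeff.
Qed.

Lemma besselcE n k : besselc n k = (-1) ^+ k / (k`!%:R * (k + n)`!%:R).
Proof. by rewrite /besselc natrM. Qed.

Lemma factSR k : (k.+1`!%:R : R) = (k%:R + 1) * k`!%:R.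
Proof. by rewrite factS natrM -natr1. Qed.

Lemma factR_neq0 k : (k`!%:R : R) != 0.
Proof. by rewrite pnatr_eq0 -lt0n fact_gt0. Qed.

(** On coefficients, this is the classical rule (x^(-n) J_n)' = - x^(-n) J_(n+1). *)
Lemma pseries_diffs_besselc n :
  pseries_diffs (besselc n) = (fun k => - besselc n.+1 k).
Proof.
apply/funext => k; rewrite /pseries_diffs !besselcE addnS addSn factSR exprS.
rewrite -natr1.
have a0 := factR_neq0 k; have b0 := factR_neq0 (k + n).+1.
have c0 : (k%:R + 1 : R) != 0 by rewrite natr1 pnatr_eq0.
move: (k`!%:R) ((k + n).+1`!%:R) (k%:R + 1) a0 b0 c0 => a b c a0 b0 c0.
by field; rewrite a0 b0 c0.
Qed.

Lemma is_derive_besselg n u :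
  is_derive u (1 : R) (besselg n) (- besselg n.+1 u).
Proof.
have E p v : pseries (fun k => - besselc p k) v = - pseries (besselc p) v.
  apply/funext => N; rewrite /pseries /series/= !fctE -sumrN.
  by apply: eq_bigr => i _; rewrite mulNr.
have -> : - besselg n.+1 u = limn (pseries (pseries_diffs (besselc n)) u).
  by rewrite pseries_diffs_besselc E limN//; exact: is_cvg_besselg.
(* Termwise differentiation at u needs convergence at a point of larger modulus; the series being
   entire, |u| + 1 will do. *)
apply: (@pseries_snd_diffs _ _ (`|u| + 1)).
- exact: is_cvg_besselg.
- by rewrite pseries_diffs_besselc E; apply: is_cvgN; exact: is_cvg_besselg.
- rewrite pseries_diffs_besselc pseries_diffsN pseries_diffs_besselc.
  rewrite (_ : - _ = besselc n.+2); first exact: is_cvg_besselg.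
  by apply/funext => k; rewrite fctE opprK.
- by rewrite [ltRHS]ger0_norm ?addr_ge0// ltrDl.
Qed.

(** The recurrence J_n + J_(n+2) = (2 (n+1) / x) J_(n+1) at x = 2 sqrt u. Together with g_n' = -
    g_(n+1) it is the differential equation u g'' + (n+1) g' + g = 0 for g = g_n. *)
Lemma besselg_rec n u :
  u * besselg n.+2 u = n.+1%:R * besselg n.+1 u - besselg n u.
Proof.
pose s : nat -> R := fun k => n.+1%:R * (besselc n.+1 k * u ^+ k) - besselc n k * u ^+ k.
have h1 : series s @ \oo --> n.+1%:R * besselg n.+1 u - besselg n u.
  have -> : series s = (fun N => n.+1%:R * pseries (besselc n.+1) u N - pseries (besselc n) u N).
    apply/funext => N; rewrite /series/= /s sumrB -mulr_sumr.
    by rewrite /pseries /series/=.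
  by apply: cvgB; [apply: cvgMl_tmp|]; exact: is_cvg_besselg.
have h2 : series s @ \oo --> u * besselg n.+2 u.
  (* The term of index 0 of [s] is zero, and its term of index k+1 is u times the k-th term of
     g_(n+2). *)
  rewrite -cvg_shiftS.
  rewrite (_ : (fun N => _) = (fun N => u * pseries (besselc n.+2) u N)); last first.
    apply/funext => N; rewrite /series/= big_nat_recl//= {1}/s /besselc.
    rewrite !expr0 fact0 !mul1n !add0n !mulr1 !mul1r factS natrM invfM mulrA.
    rewrite mulfV// mul1r subrr add0r mulr_sumr; apply: eq_bigr => k _.
    rewrite /s /pseries /= -/(besselc n.+2 k) !besselcE !(addnS, addSn) !factSR.
    rewrite !exprS -!natr1 !natrD.
    have a0 := factR_neq0 k; have b0 := factR_neq0 (k + n).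
    have c0 : (k%:R + 1 : R) != 0 by rewrite natr1 pnatr_eq0.
    have d0 : (k%:R + n%:R + 1 : R) != 0 by rewrite -natrD natr1 pnatr_eq0.
    have e0 : (k%:R + n%:R + 1 + 1 : R) != 0 by rewrite -natrD !natr1 pnatr_eq0.
    move: (k`!%:R) ((k + n)`!%:R) (k%:R) (n%:R) a0 b0 c0 d0 e0.
    move=> a b K N' a0 b0 c0 d0 e0.
    by field; rewrite ?a0 ?b0 ?c0 ?d0 ?e0.
  by apply: cvgMl_tmp; exact: is_cvg_besselg.
exact: (cvg_unique _ h2 h1).
Qed.

Lemma besselg0 n : besselg n 0 = (n`!%:R)^-1.
Proof.
rewrite /besselg; apply: cvg_lim => //.
rewrite -cvg_shiftS; apply: cvg_near_cst; apply: nearW => N /=.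
rewrite /pseries /series/= big_nat_recl//= big1 ?addr0.
  by rewrite /besselc !expr0 fact0 mul1n add0n mulr1 mul1r.
by move=> i _; rewrite exprS mul0r mulr0.
Qed.

Lemma besselg_le1 n u : 0 <= u -> `|besselg n u| <= 1.
Proof.
rewrite le_eqVlt => /predU1P[<-|u0].
  rewrite besselg0 ger0_norm// invf_le1 ?ltr0n ?fact_gt0//.
  by rewrite ler1n fact_gt0.
pose E v := besselg n v ^+ 2 + v * besselg n.+1 v ^+ 2.
(* Replacing u g'' by - (n+1) g' - g cancels the mixed term 2 g g' and leaves g'^2 - 2 (n+1)
   g'^2. *)
pose E' v := - n.*2.+1%:R * besselg n.+1 v ^+ 2.
have dE v : is_derive v (1 : R) E (E' v).
  have h0 := is_derive_besselg n v.
  have h1 := is_derive_besselg n.+1 v.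
  apply: is_derive_eq.
  rewrite /E' /GRing.scale/= !mulr1 -muln2 -natr1 natrM.
  have := besselg_rec n v; rewrite -natr1 => r.
  transitivity (- (2 * (besselg n v * besselg n.+1 v)) + besselg n.+1 v ^+ 2 -
     2 * besselg n.+1 v * (v * besselg n.+2 v)); first by ring.
  by rewrite r; ring.
have : E u <= E 0.
  apply: (@ler0_derive1_nincr _ E 0 u) => //; rewrite ?lexx ?(ltW u0)//.
  - move=> v _; rewrite derive1E; have [_ ->] := dE v.
    by rewrite /E' mulNr oppr_le0 mulr_ge0 ?sqr_ge0.
  - apply: continuous_subspaceT => v; apply/differentiable_continuous/derivable1_diffP.
    by have [] := dE v.
rewrite /E mul0r addr0 besselg0 => h.
rewrite -(@ler_pXn2r _ 2) ?nnegrE// expr1n real_normK ?num_real//.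
apply: (@le_trans _ _ (n`!%:R^-1 ^+ 2)).
  by apply: le_trans h; rewrite lerDl mulr_ge0 ?sqr_ge0// ltW.
rewrite expr_le1// ?invr_ge0// invf_le1 ?ltr0n ?fact_gt0//.
by rewrite ler1n fact_gt0.
Qed.

(** Since the coefficients are at most 1/k! in absolute value, the tail is dominated termwise by
    that of the exponential series at N, uniformly in u. *)
Lemma besselg_sub_le n u N (k : nat) : `|u| <= N ->
  `|besselg n u - pseries (besselc n) u k| <= expR N - series (exp_coeff N) k.
Proof.
move=> uN.
have h1 : `|pseries (besselc n) u i - pseries (besselc n) u k| @[i --> \oo] -->
   `|besselg n u - pseries (besselc n) u k|.
  by apply: cvg_norm; apply: cvgB; [exact: is_cvg_besselg|exact: cvg_cst].
have h2 : series (exp_coeff N) i - series (exp_coeff N) k @[i --> \oo] -->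
   expR N - series (exp_coeff N) k.
  by apply: cvgB; [exact: is_cvg_series_exp_coeff|exact: cvg_cst].
apply: (ler_cvg_to h1 h2); near=> i.
have ki : (k <= i)%N by near: i; exact: nbhs_infty_ge.
rewrite /pseries !sub_series_geq//.
apply: le_trans (ler_norm_sum _ _ _) _; apply: ler_sum => j _.
rewrite normrM normrX /exp_coeff/= mulrC ler_pM ?exprn_ge0//.
- by apply: lerXn2r; rewrite ?nnegrE//; exact: le_trans uN.
- exact: besselc_le.
Unshelve. all: by end_near. Qed.

(** It serves for negative arguments, which the energy estimate does not reach. *)
Lemma besselg_le_exp n u : `|besselg n u| <= expR `|u|.
Proof.
have := @besselg_sub_le n u `|u| 0%N (lexx _).
by rewrite /pseries /series/= !big_geq// !subr0.
Qed.

Lemma besselg_approx n (N e : R) : 0 < e -> exists k, forall u, `|u| <= N ->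
  `|besselg n u - pseries (besselc n) u k| <= e.
Proof.
move=> e0.
have /cvgrPdist_le /(_ _ e0)[k _ hk] : series (exp_coeff N) @ \oo --> expR N.
  exact: is_cvg_series_exp_coeff.
exists k => u uN; apply: le_trans (besselg_sub_le _ _ uN) _.
by apply: le_trans (ler_norm _) _; exact: (hk k (leqnn k)).
Qed.

Lemma besselJ_sqrt (u : R) : 0 < u ->
  besselJ 1 (2 * Num.sqrt u) / Num.sqrt u = besselg 1 u.
Proof.
move=> u0; have s0 : Num.sqrt u != 0 by rewrite gt_eqF// sqrtr_gt0.
rewrite /besselJ (_ : series _ = (fun N => pseries (besselc 1) u N * Num.sqrt u)).
  rewrite (cvg_lim _ (cvgMr_tmp (b := Num.sqrt u) (@is_cvg_besselg 1 u)))//.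
  by rewrite mulfK.
apply/funext => N; rewrite /pseries /series/= mulr_suml; apply: eq_bigr => k _.
rewrite -[RHS]mulrA; congr (_ * _).
have -> : 2 * Num.sqrt u / 2 = Num.sqrt u by field.
rewrite exprD expr1 exprM.
by rewrite sqr_sqrtr// ltW.
Qed.

Lemma continuous_besselg n : continuous (besselg n).
Proof.
move=> u; apply/differentiable_continuous/derivable1_diffP.
by have [] := is_derive_besselg n u.
Qed.

Lemma measurable_besselg n : measurable_fun setT (besselg n).
Proof. apply: continuous_measurable_fun => u; exact: continuous_besselg. Qed.
End Bessel.

(** * Laplace transform of the Bessel kernel *)

Section HalfLineFTC.
Context {R : realType}.
Local Notation mu := (@lebesgue_measure R).
Local Notation D := (@Rpos R).
Local Notation integ f := (mu.-integrable D (EFin \o f)).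
Local Notation I f := (\int[mu]_(t in D) f t)%R.

Lemma continuous_is_derive (f : R -> R) (x df : R) : is_derive x (1 : R) f df ->
  {for x, continuous f}.
Proof. by move=> [h _]; apply/differentiable_continuous/derivable1_diffP. Qed.

Lemma measurable_continuous (f : R -> R) : continuous f -> measurable_fun D f.
Proof.
by move=> cf; apply: measurable_funTS; apply: continuous_measurable_fun => u; exact: cf.
Qed.

(** The fundamental theorem on ]0, n] combined with dominated convergence, |h| being the dominating
    function; the behaviour of F at infinity is thus tested along the integers. *)
Lemma Rint_FTC (F h : R -> R) : (forall t : R, is_derive t (1 : R) F (h t)) ->
  continuous h -> integ h -> F n%:R @[n --> \oo] --> 0 -> I h = - F 0.
Proof.
move=> dF ch ih F0.
pose H (n : nat) (t : R) := h t * \1_(`]0, n%:R]%classic) t.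
have h1 : I (H n) @[n --> \oo] --> I h.
  apply: (Rint_dominated (g := fun t => `|h t|)).
  - move=> n; apply: measurable_funM; first exact: measurable_continuous.
    by apply: measurable_funTS; apply: measurable_indic; exact: measurable_itv.
  - exact: measurable_continuous.
  - exact: integ_norm.
  - move=> t t0; apply: cvg_near_cst; near=> n.
    rewrite /H indicE mem_set ?mulr1//= in_itv/= t0/=.
    by near: n; exact: nbhs_infty_ger.
  - move=> n t t0; rewrite /H normrM ler_piMr// indicE.
    by case: (_ \in _); rewrite ?normr1 ?normr0.
have h2 : \forall n \near \oo, F n%:R - F 0 = I (H n).
  near=> n.
  have n0 : (0 : R) < n%:R by rewrite ltr0n; near: n; exact: nbhs_infty_gt.
  have -> : I (H n) = (\int[mu]_(t in `]0%R, n%:R]) h t)%R.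
    rewrite /Rintegral; congr fine.
    transitivity (\int[mu]_(t in D) (((fun t => (h t)%:E) \_ `]0%R, n%:R]) t))%E.
      apply: eq_integral => t _; rewrite /H patchE indicE.
      by case: (_ \in _); rewrite ?mulr1 ?mulr0.
    rewrite -integral_mkcondr; congr integral.
    apply/seteqP; split => t /=; rewrite ?RposE /= !in_itv/= ?andbT.
      by case.
    by move=> /andP[-> ->].
  rewrite Rintegral_itv_obnd_cbnd; last first.
    apply: integrableS ih; [exact: measurable_Rpos|exact: measurable_itv|].
    by move=> t /=; rewrite RposE in_itv/= => /andP[].
  rewrite /Rintegral (continuous_FTC2 (F := F) n0)//.
  - by apply: continuous_subspaceT => t; exact: ch.
  - split; first by move=> t _; have [] := dF t.
      by apply: cvg_at_right_filter; exact: continuous_is_derive (dF 0).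
    by apply: cvg_at_left_filter; exact: continuous_is_derive (dF n%:R).
  - by move=> t _; rewrite derive1E; have [_ ->] := dF t.
have h3 : F n%:R - F 0 @[n --> \oo] --> - F 0.
  by rewrite -[X in _ --> X]add0r; apply: cvgB => //; exact: cvg_cst.
exact: (cvg_unique _ h1 (cvg_trans (near_eq_cvg h2) h3)).
Unshelve. all: by end_near. Qed.

Lemma le_expR_inv (d t : R) : 0 < d -> t <= d^-1 * expR (d * t).
Proof.
move=> d0; rewrite -ler_pdivrMl ?invr_gt0// invrK.
by apply: le_trans (expR_ge1Dx _); rewrite lerDr.
Qed.

Lemma cvg_expRN (a : R) : 0 < a -> expR (- (a * n%:R)) @[n --> \oo] --> 0.
Proof.
move=> a0; rewrite (_ : (fun n => _) = GRing.exp (expR (- a))).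
  by apply: cvg_expr; rewrite ger0_norm ?expR_ge0// expR_lt1 oppr_lt0.
by apply/funext => n; rewrite -expRM_natr mulNr.
Qed.

End HalfLineFTC.

(** * Integration by parts and differentiation in s *)

Section Laplace.
Context {R : realType}.
Local Notation mu := (@lebesgue_measure R).
Local Notation D := (@Rpos R).
Local Notation integ f := (mu.-integrable D (EFin \o f)).
Local Notation I f := (\int[mu]_(t in D) f t)%R.
Implicit Types (a b d s t C K : R) (f g phi : R -> R).

Lemma integ_growth phi f a d C K : d < a -> continuous phi -> continuous f ->
  (forall t, 0 <= t -> `|phi t| <= C * expR (d * t)) ->
  (forall t, 0 <= t -> `|f t| <= K * expR (- (a * t))) ->
  integ (fun t => phi t * f t).
Proof.
move=> da cphi cf hphi hf.
have C0 : 0 <= C.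
  by apply: le_trans (normr_ge0 _) _; have := hphi 0 (lexx _); rewrite mulr0 expR0 mulr1; exact.
have K0 : 0 <= K.
  by apply: le_trans (normr_ge0 _) _; have := hf 0 (lexx _); rewrite mulr0 oppr0 expR0 mulr1; exact.
apply: (@integ_dom _ _ _ (fun t => C * K * expR (- ((a - d) * t)))).
- by apply: measurable_funM; exact: measurable_continuous.
- move=> t t0; rewrite normrM.
  apply: le_trans (ler_pM _ _ (hphi _ (ltW t0)) (hf _ (ltW t0))) _ => //.
  by rewrite mulrACA -expRD ler_wpM2l ?mulr_ge0// ler_expR; lra.
- by apply: integZ; apply: integrable_expN; rewrite subr_gt0.
Qed.

(** The left-hand side integrates (phi f)', and phi f = O(e^(-(a - d) t)) has no boundary term at
    infinity. *)
Lemma Rint_parts phi phi' f f' a d C K : d < a ->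
  (forall t, is_derive t (1 : R) phi (phi' t)) -> continuous phi' ->
  (forall t, is_derive t (1 : R) f (f' t)) -> continuous f' ->
  (forall t, 0 <= t -> `|phi t| <= C * expR (d * t)) ->
  (forall t, 0 <= t -> `|phi' t| <= C * expR (d * t)) ->
  (forall t, 0 <= t -> `|f t| <= K * expR (- (a * t))) ->
  (forall t, 0 <= t -> `|f' t| <= K * expR (- (a * t))) ->
  I (fun t => phi' t * f t) + I (fun t => phi t * f' t) = - (phi 0 * f 0).
Proof.
move=> da dphi cphi' df cf' hphi hphi' hf hf'.
have cphi : continuous phi by move=> t; exact: continuous_is_derive (dphi t).
have cf : continuous f by move=> t; exact: continuous_is_derive (df t).
have i1 := integ_growth da cphi' cf hphi' hf.
have i2 := integ_growth da cphi cf' hphi hf'.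
rewrite -RintD//.
apply: (@Rint_FTC _ (fun t => phi t * f t)).
- move=> t; have h1 := dphi t; have h2 := df t.
  by apply: is_derive_eq; rewrite /GRing.scale/= addrC mulrC.
- move=> t; apply: (@continuousD _ R^o R^o (fun t => phi' t * f t) (fun t => phi t * f' t)).
    by apply: (@continuousM _ R^o) => //; [exact: cphi'|exact: cf].
  by apply: (@continuousM _ R^o) => //; [exact: cphi|exact: cf'].
- exact: integD.
- apply/norm_cvg0P.
  apply: (@squeeze_cvgr _ _ _ _ (fun=> 0) (fun n => C * K * expR (- ((a - d) * n%:R)))).
  + near=> n; rewrite normr_ge0/= normrM.
    apply: le_trans (ler_pM _ _ (hphi _ _) (hf _ _)) _ => //.
    rewrite mulrACA -expRD le_eqVlt; apply/orP; left; apply/eqP.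
    by congr (_ * expR _); lra.
  + exact: cvg_cst.
  + rewrite -[X in _ --> X](mulr0 (C * K)); apply: cvgMl_tmp.
    by apply: cvg_expRN; rewrite subr_gt0.
Unshelve. all: by end_near. Qed.

(* [ec a b t + i es a b t = exp (- (a + i b) t)] *)
Definition ec a b t := expR (- (a * t)) * cos (b * t).
Definition es a b t := - (expR (- (a * t)) * sin (b * t)).

Lemma is_derive_ec a b t : is_derive t (1 : R) (ec a b) (- a * ec a b t + b * es a b t).
Proof. by apply: is_derive_eq; rewrite /ec /es /GRing.scale/=; ring. Qed.

Lemma is_derive_es a b t : is_derive t (1 : R) (es a b) (- a * es a b t - b * ec a b t).
Proof. by apply: is_derive_eq; rewrite /ec /es /GRing.scale/=; ring. Qed.

Lemma ec_0 a b : ec a b 0 = 1.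
Proof. by rewrite /ec !mulr0 oppr0 expR0 cos0 mulr1. Qed.

Lemma es_0 a b : es a b 0 = 0.
Proof. by rewrite /es !mulr0 sin0 mulr0 oppr0. Qed.

Lemma ec_le a b t : `|ec a b t| <= expR (- (a * t)).
Proof.
rewrite /ec normrM ger0_norm ?expR_ge0// ler_piMr ?expR_ge0//.
by rewrite ler_norml cos_geN1 cos_le1.
Qed.

Lemma es_le a b t : `|es a b t| <= expR (- (a * t)).
Proof.
rewrite /es normrN normrM ger0_norm ?expR_ge0// ler_piMr ?expR_ge0//.
by rewrite ler_norml sin_geN1 sin_le1.
Qed.


Lemma sqr_growth d t : 0 < d -> 0 <= t ->
  (1 + t) ^+ 2 <= (1 + d^-1) ^+ 2 * expR (2 * d * t).
Proof.
move=> d0 t0.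
rewrite (_ : expR _ = expR (d * t) ^+ 2); last first.
  by rewrite -expRM_natr; congr expR; ring.
have d1 : 0 <= d^-1 by rewrite invr_ge0 ltW.
rewrite -exprMn lerXn2r ?nnegrE ?mulr_ge0 ?addr_ge0 ?expR_ge0//.
rewrite mulrDl mul1r; apply: lerD; last exact: le_expR_inv.
by rewrite -expR0 ler_expR mulr_ge0// ltW.
Qed.

Lemma besselg_growth n d s t : 0 < d -> - d <= s -> 0 <= t ->
  `|besselg n (s * t)| <= expR (d * t).
Proof.
move=> d0 ds t0; have [s0|s0] := leP 0 s.
  apply: le_trans (besselg_le1 _ _) _; first by rewrite mulr_ge0.
  by rewrite -expR0 ler_expR mulr_ge0// ltW.
apply: le_trans (besselg_le_exp _ _) _; rewrite ler_expR normrM.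
by rewrite (ger0_norm t0) ler_wpM2r// ltr0_norm// lerNl.
Qed.

(** The constant of [sqr_growth] for d = a/8. The rate a/2 of [poly_besselg_growth] is a/4 for the
    polynomial and a/4 for the Bessel factor; half of the decay rate a remains. *)
Definition growth_const a := (1 + (a / 8)^-1) ^+ 2.

Lemma poly_besselg_growth n a s t p : 0 < a -> - (a / 4) <= s -> 0 <= t ->
  `|p| <= (1 + t) ^+ 2 -> `|p * besselg n (s * t)| <= growth_const a * expR (a / 2 * t).
Proof.
move=> a0 hs t0 hp; rewrite normrM.
have h1 : `|p| <= growth_const a * expR (2 * (a / 8) * t).
  by apply: le_trans hp _; apply: sqr_growth => //; lra.
have h2 : `|besselg n (s * t)| <= expR (a / 4 * t) by apply: besselg_growth => //; lra.
apply: le_trans (ler_pM _ _ h1 h2) _ => //.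
by rewrite -[leLHS]mulrA -expRD ler_wpM2l ?sqr_ge0// ler_expR; lra.
Qed.

Lemma is_derive_besselg_comp n s t :
  is_derive t (1 : R) (fun t => besselg n (s * t)) (- (s * besselg n.+1 (s * t))).
Proof.
have h := is_derive_besselg n (s * t).
have h2 : is_derive t (1 : R) (fun t : R => s * t) s.
  by apply: is_derive_eq; rewrite /GRing.scale/= mulr1.
have := @is_derive1_comp _ (besselg n) (fun t => s * t) t _ _ h h2.
by move=> h3; apply: (is_derive_eq h3); rewrite /GRing.scale/=; ring.
Qed.

Definition laplace1 f s := I (fun t => t * besselg 1 (s * t) * f t).
Definition laplace2 f s := I (fun t => t ^+ 2 * besselg 2 (s * t) * f t).

Lemma continuous_besselg_comp n s : continuous (fun t => besselg n (s * t)).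
Proof. by move=> t; exact: continuous_is_derive (is_derive_besselg_comp n s t). Qed.

Lemma integ_laplace1 f a s : 0 < a -> - (a / 4) <= s -> continuous f ->
  (forall t, 0 <= t -> `|f t| <= expR (- (a * t))) ->
  integ (fun t => t * besselg 1 (s * t) * f t).
Proof.
move=> a0 hs cf hf.
apply: (@integ_growth _ _ a (a / 2) (growth_const a) 1) => //.
- lra.
- move=> t; apply: (@continuousM _ R^o (fun t => t)) => //; exact: continuous_besselg_comp.
- move=> t t0; apply: poly_besselg_growth => //.
  by rewrite ger0_norm//; nra.
- by move=> t t0; rewrite mul1r hf.
Qed.

Lemma integ_laplace2 f a s : 0 < a -> - (a / 4) <= s -> continuous f ->
  (forall t, 0 <= t -> `|f t| <= expR (- (a * t))) ->
  integ (fun t => t ^+ 2 * besselg 2 (s * t) * f t).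
Proof.
move=> a0 hs cf hf.
apply: (@integ_growth _ _ a (a / 2) (growth_const a) 1) => //.
- lra.
- move=> t; apply: (@continuousM _ R^o (fun t => t ^+ 2)); first exact: exprn_continuous.
  exact: continuous_besselg_comp.
- move=> t t0; apply: poly_besselg_growth => //.
  by rewrite ger0_norm ?exprn_ge0//; nra.
- by move=> t t0; rewrite mul1r hf.
Qed.

Lemma is_derive_laplace1 f a s : 0 < a -> - (a / 4) < s -> continuous f ->
  (forall t, 0 <= t -> `|f t| <= expR (- (a * t))) ->
  is_derive s (1 : R) (laplace1 f) (- laplace2 f s).
Proof.
move=> a0 hs cf hf.
pose F (x y : R) := y * besselg 1 (x * y) * f y.
have dF x y : is_derive x (1 : R) (F ^~ y) (- (y ^+ 2 * besselg 2 (x * y) * f y)).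
  have h : is_derive x (1 : R) (fun x => besselg 1 (x * y)) (- (y * besselg 2 (x * y))).
    have := is_derive_besselg_comp 1 y x.
    by under eq_fun do rewrite mulrC; rewrite (mulrC y x).
  have -> : - (y ^+ 2 * besselg 2 (x * y) * f y) =
    (y * f y) *: (- (y * besselg 2 (x * y))) by rewrite /GRing.scale/=; ring.
  have -> : F ^~ y = (y * f y) \*: (fun x => besselg 1 (x * y)).
    by apply/funext => z; rewrite /F /= /GRing.scale/=; ring.
  exact: is_deriveZ.
(* It dominates the s-derivative of the integrand uniformly on the interval: growth of rate a/2
   against the decay of rate a of [f]. *)
pose G (y : R) := growth_const a * expR (- (a / 2 * y)).
have G0 y : 0 <= G y by rewrite /G mulr_ge0 ?sqr_ge0 ?expR_ge0.
have sI : s \in `] - (a / 4), s + 1[ by rewrite in_itv/= hs/= ltrDl.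
have intF x : `] - (a / 4), s + 1[%classic x -> mu.-integrable D (EFin \o F x).
  rewrite /= in_itv/= => /andP[hx _].
  by apply: integ_laplace1 hf => //; exact: ltW.
have derF x y : `] - (a / 4), s + 1[%classic x -> D y -> derivable (F ^~ y) x 1.
  by move=> _ _; have [] := dF x y.
have iG : mu.-integrable D (EFin \o G).
  by apply: integZ; apply: integrable_expN; lra.
have d1E x y : partial1of2 F x y = - (y ^+ 2 * besselg 2 (x * y) * f y).
  by rewrite partial1of2E; have [_ ->] := dF x y.
have Gub x y : `] - (a / 4), s + 1[%classic x -> D y -> `|partial1of2 F x y| <= G y.
  rewrite /= in_itv/= RposE => /andP[hx _] y0; rewrite d1E normrN normrM.
  have h1 : `|y ^+ 2 * besselg 2 (x * y)| <= growth_const a * expR (a / 2 * y).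
    apply: poly_besselg_growth => //; rewrite ?ltW//.
    by rewrite ger0_norm ?exprn_ge0 ?(ltW y0)//; nra.
  apply: le_trans (ler_pM _ _ h1 (hf _ (ltW y0))) _ => //.
  by rewrite -[leLHS]mulrA -expRD /G ler_wpM2l ?sqr_ge0// ler_expR; lra.
have dd := derivable_under_integral measurable_Rpos sI intF derF G0 iG Gub.
apply: DeriveDef; first exact: dd.
have := differentiation_under_integral measurable_Rpos sI intF derF G0 iG Gub.
rewrite derive1E => ->.
have iM : integ (fun t => t ^+ 2 * besselg 2 (s * t) * f t).
  by apply: integ_laplace2 hf => //; exact: ltW.
rewrite -mulN1r /laplace2 -RintZ//.
by apply: eq_Rint => t _; rewrite d1E mulN1r.
Qed.

End Laplace.

(** * The differential equation of the Laplace transform, for p = a + ib *)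

Section LaplaceBessel.
Context {R : realType}.
Local Notation mu := (@lebesgue_measure R).
Local Notation D := (@Rpos R).
Local Notation integ f := (mu.-integrable D (EFin \o f)).
Local Notation I f := (\int[mu]_(t in D) f t)%R.
Variables a b : R.
Hypothesis a0 : 0 < a.
Implicit Types (s t : R) (phi : R -> R).
Local Notation ec := (ec a b).
Local Notation es := (es a b).

Let cec : continuous ec.
Proof. by move=> t; exact: continuous_is_derive (is_derive_ec a b t). Qed.

Let ces : continuous es.
Proof. by move=> t; exact: continuous_is_derive (is_derive_es a b t). Qed.

Let clin (x y : R) : continuous (fun t => x * ec t + y * es t).
Proof.
move=> t; apply: (@continuousD _ R^o R^o (fun t => x * ec t) (fun t => y * es t)).
  by apply: (@continuousM _ R^o (fun=> x)); [exact: cst_continuous|exact: cec].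
by apply: (@continuousM _ R^o (fun=> y)); [exact: cst_continuous|exact: ces].
Qed.

(** Large enough for [ec], [es] and both of their derivatives, as combinations of [ec] and [es]. *)
Let K := 1 + a + `|b|.

Let lin_le (x y t : R) : `|x| + `|y| <= K ->
  `|x * ec t + y * es t| <= K * expR (- (a * t)).
Proof.
move=> h; apply: le_trans (ler_normD _ _) _; rewrite (normrM x) (normrM y).
apply: (@le_trans _ _ ((`|x| + `|y|) * expR (- (a * t)))); last by rewrite ler_wpM2r ?expR_ge0.
by rewrite mulrDl; apply: lerD; apply: ler_wpM2l => //; [exact: ec_le|exact: es_le].
Qed.

Let is_derive_ec' t : is_derive t (1 : R) ec (- a * ec t + b * es t).
Proof. exact: is_derive_ec. Qed.

Let is_derive_es' t : is_derive t (1 : R) es (- b * ec t + - a * es t).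
Proof. by apply: (is_derive_eq (is_derive_es a b t)); ring. Qed.

(** The real and imaginary parts of \int phi' e^(-pt) = - phi(0) + p \int phi e^(-pt). *)
Lemma Rint_parts_ec_es phi phi' d C : d < a ->
  (forall t, is_derive t (1 : R) phi (phi' t)) -> continuous phi' ->
  (forall t, 0 <= t -> `|phi t| <= C * expR (d * t)) ->
  (forall t, 0 <= t -> `|phi' t| <= C * expR (d * t)) ->
  I (fun t => phi' t * ec t) = - phi 0
    + a * I (fun t => phi t * ec t) - b * I (fun t => phi t * es t) /\
  I (fun t => phi' t * es t) =
    a * I (fun t => phi t * es t) + b * I (fun t => phi t * ec t).
Proof.
move=> da dphi cphi' h h'.
have cphi : continuous phi by move=> t; exact: continuous_is_derive (dphi t).
have ka : `|- a| = a by rewrite normrN gtr0_norm.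
have Kge : 1 <= K by rewrite /K -addrA lerDl addr_ge0// ltW.
have l1 t : 0 <= t -> `|ec t| <= K * expR (- (a * t)).
  by move=> _; have := @lin_le 1 0 t; rewrite mul1r mul0r addr0; apply; rewrite normr1 normr0 addr0.
have l2 t : 0 <= t -> `|es t| <= K * expR (- (a * t)).
  by move=> _; have := @lin_le 0 1 t; rewrite mul1r mul0r add0r; apply; rewrite normr1 normr0 add0r.
have l3 t : 0 <= t -> `|- a * ec t + b * es t| <= K * expR (- (a * t)).
  by move=> _; apply: lin_le; rewrite ka /K -addrA lerDr.
have l4 t : 0 <= t -> `|- b * ec t + - a * es t| <= K * expR (- (a * t)).
  by move=> _; apply: lin_le; rewrite ka normrN [leLHS]addrC /K -addrA lerDr.
have i1 := integ_growth da cphi cec h l1.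
have i2 := integ_growth da cphi ces h l2.
have e1 := Rint_parts da dphi cphi' is_derive_ec' (@clin _ _) h h' l1 l3.
have e2 := Rint_parts da dphi cphi' is_derive_es' (@clin _ _) h h' l2 l4.
have E x y : I (fun t => phi t * (x * ec t + y * es t)) =
    x * I (fun t => phi t * ec t) + y * I (fun t => phi t * es t).
  rewrite -!RintZ// -RintD; [|exact: integZ..].
  by apply: eq_Rint => t _; ring.
move: e1 e2; rewrite !E ec_0 es_0.
move=> /(canRL (addrK _)) -> /(canRL (addrK _)) ->.
split; ring.
Qed.

Let a2 : a / 2 < a. Proof. by have := a0; lra. Qed.

Let Cst_sqr t : 0 <= t -> (1 + t) ^+ 2 <= growth_const a * expR (a / 2 * t).
Proof.
move=> t0; have h := @sqr_growth R (a / 8) t.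
apply: le_trans (h _ t0) _; first by rewrite divr_gt0.
rewrite /growth_const ler_wpM2l ?sqr_ge0// ler_expR ler_wpM2r//.
by rewrite (_ : 2 * (a / 8) = a / 4); [have := a0; lra|field].
Qed.

(** By [besselg_rec], t g_1(st) is the t-derivative of t^2 g_2(st), which vanishes at 0. Integrating
    by parts, y = p \int t^2 g_2(st) e^(-pt) dt, and this integral is - y'(s). *)
Lemma laplace_bessel_rec s : - (a / 4) < s ->
  laplace1 ec s = a * laplace2 ec s - b * laplace2 es s /\
  laplace1 es s = a * laplace2 es s + b * laplace2 ec s.
Proof.
move=> hs.
have hd t : is_derive t (1 : R) (fun t => t ^+ 2 * besselg 2 (s * t)) (t * besselg 1 (s * t)).
  have h := is_derive_besselg_comp 2 s t.
  apply: is_derive_eq; rewrite /GRing.scale/= !mulr1.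
  have := besselg_rec 1 (s * t) => r.
  transitivity (2 * t * besselg 2 (s * t) - t * (s * t * besselg 3 (s * t))).
    by ring.
  by rewrite r; ring.
have [] := @Rint_parts_ec_es (fun t => t ^+ 2 * besselg 2 (s * t))
  (fun t => t * besselg 1 (s * t)) (a / 2) (growth_const a) a2 hd.
- move=> t; apply: (@continuousM _ R^o (fun t => t)) => //; exact: continuous_besselg_comp.
- move=> t t0; apply: poly_besselg_growth => //; first exact: ltW.
  by rewrite ger0_norm ?exprn_ge0//; nra.
- move=> t t0; apply: poly_besselg_growth => //; first exact: ltW.
  by rewrite ger0_norm//; nra.
by rewrite expr0n/= mul0r oppr0 add0r.
Qed.

Let q2 : a ^+ 2 + b ^+ 2 != 0.
Proof. by rewrite gt_eqF// ltr_wpDr ?sqr_ge0// exprn_gt0. Qed.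

(** [al] + i [be] is 1/p. *)
Let al := a / (a ^+ 2 + b ^+ 2).
Let be := - b / (a ^+ 2 + b ^+ 2).

(** As g(0) = 1, this is \int t e^(-pt) dt = p^-2. The choices phi = 1 and phi = t in
    [Rint_parts_ec_es] give p \int e^(-pt) = 1 and p \int t e^(-pt) = \int e^(-pt), two real linear
    systems of determinant a^2 + b^2. *)
Let Lam0 : laplace1 ec 0 = al ^+ 2 - be ^+ 2 /\ laplace1 es 0 = 2 * al * be.
Proof.
have E f : laplace1 f 0 = I (fun t => t * f t).
  apply: eq_Rint => t _; rewrite mul0r besselg0.
  by rewrite (_ : 1`! = 1%N)// invr1 mulr1.
have [] := @Rint_parts_ec_es (fun=> 1) (fun=> 0) (a / 2) (growth_const a) a2.
- exact: cst_continuous.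
- move=> t t0; rewrite normr1; apply: le_trans (Cst_sqr t0).
  by rewrite expr_ge1// ?addr_ge0// lerDl.
- move=> t t0; rewrite normr0; apply: le_trans (Cst_sqr t0).
  by rewrite sqr_ge0.
have [] := @Rint_parts_ec_es id (fun=> 1) (a / 2) (growth_const a) a2.
- exact: cst_continuous.
- move=> t t0; apply: le_trans (Cst_sqr t0).
  by rewrite ger0_norm//; nra.
- move=> t t0; rewrite normr1; apply: le_trans (Cst_sqr t0).
  by rewrite expr_ge1// ?addr_ge0// lerDl.
have Z f : I (fun t => 0 * f t) = 0.
  rewrite (@eq_Rint _ _ _ (fun=> 0)); last by move=> t _; rewrite mul0r.
  by rewrite Rintegral_cst ?mul0r//; exact: measurable_Rpos.
rewrite !E !Z oppr0 add0r.
set x := I (fun t => 1 * ec t); set y := I (fun t => 1 * es t).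
set X := I (fun t => t * ec t); set Y := I (fun t => t * es t).
move=> e1 e2 e3 e4.
have hx : x = al.
  apply: (mulIf q2); rewrite /al mulfVK//.
  have -> : x * (a ^+ 2 + b ^+ 2) = a * (- 1 + a * x - b * y) + b * (a * y + b * x) + a by ring.
  by rewrite -e3 -e4 !mulr0 !add0r.
have hy : y = be.
  apply: (mulIf q2); rewrite /be mulfVK//.
  have -> : y * (a ^+ 2 + b ^+ 2) = a * (a * y + b * x) - b * (- 1 + a * x - b * y) - b by ring.
  by rewrite -e3 -e4 !mulr0 subrr add0r.
have hX : X * (a ^+ 2 + b ^+ 2) = a * x + b * y by rewrite e1 e2; ring.
have hY : Y * (a ^+ 2 + b ^+ 2) = a * y - b * x by rewrite e1 e2; ring.
split; apply: (mulIf q2); rewrite ?hX ?hY hx hy /al /be; field; exact: q2.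
Qed.

(** If y = L + iM satisfies y' = - y/p, then e^(t/p) y is constant; the two functions are its real
    and imaginary parts. *)
Let rotation (L M : R -> R) t :
  is_derive t (1 : R) L (- (al * L t - be * M t)) ->
  is_derive t (1 : R) M (- (al * M t + be * L t)) ->
  is_derive t (1 : R)
    (fun t => expR (al * t) * (cos (be * t) * L t - sin (be * t) * M t)) 0 /\
  is_derive t (1 : R)
    (fun t => expR (al * t) * (sin (be * t) * L t + cos (be * t) * M t)) 0.
Proof.
move: al be => x y h1 h2; split.
  by apply: is_derive_eq; rewrite /GRing.scale/=; ring.
by apply: is_derive_eq; rewrite /GRing.scale/=; ring.
Qed.

Let dLamc s : - (a / 4) < s -> is_derive s (1 : R) (laplace1 ec)
  (- (al * laplace1 ec s - be * laplace1 es s)).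
Proof.
move=> hs; have [h1 h2] := laplace_bessel_rec hs.
apply: (is_derive_eq (is_derive_laplace1 a0 hs cec _)); first by move=> t _; exact: ec_le.
by rewrite h1 h2 /al /be; field; exact: q2.
Qed.

Let dLams s : - (a / 4) < s -> is_derive s (1 : R) (laplace1 es)
  (- (al * laplace1 es s + be * laplace1 ec s)).
Proof.
move=> hs; have [h1 h2] := laplace_bessel_rec hs.
apply: (is_derive_eq (is_derive_laplace1 a0 hs ces _)); first by move=> t _; exact: es_le.
by rewrite h1 h2 /al /be; field; exact: q2.
Qed.

Let cst_of_derive (F : R -> R) s : 0 <= s ->
  (forall t, - (a / 4) < t -> is_derive t (1 : R) F 0) -> F s = F 0.
Proof.
rewrite le_eqVlt => /predU1P[<-//|s0 dF].
have a4 t : 0 <= t -> - (a / 4) < t by have := a0; lra.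
have [||c _] := @MVT _ F (fun=> 0) _ _ s0.
- by move=> x /itvP hx; apply/dF/a4; rewrite ltW// hx.
- apply: continuous_in_subspaceT => x /set_mem /= /itvP hx.
  by apply: continuous_is_derive (dF _ _); apply: a4; rewrite hx.
by rewrite mul0r => /eqP; rewrite subr_eq0 => /eqP.
Qed.

(** As c + id = e^(-s/p), the two equalities say y(s) = p^-2 e^(-s/p). They follow from the
    constancy of e^(s/p) y(s), the rotation being undone with cos^2 + sin^2 = 1. *)
Lemma laplace_besselE s : 0 <= s ->
  let c := expR (- (al * s)) * cos (be * s) in
  let d := - (expR (- (al * s)) * sin (be * s)) in
  laplace1 ec s = c * (al ^+ 2 - be ^+ 2) - d * (2 * al * be) /\
  laplace1 es s = c * (2 * al * be) + d * (al ^+ 2 - be ^+ 2).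
Proof.
move=> s0 c d; have [<- <-] := Lam0.
pose X (t : R) := expR (al * t) * (cos (be * t) * laplace1 ec t - sin (be * t) * laplace1 es t).
pose Y (t : R) := expR (al * t) * (sin (be * t) * laplace1 ec t + cos (be * t) * laplace1 es t).
have hX : X s = X 0.
  apply: (@cst_of_derive X _ s0) => t ht.
  exact: (rotation (dLamc ht) (dLams ht)).1.
have hY : Y s = Y 0.
  apply: (@cst_of_derive Y _ s0) => t ht.
  exact: (rotation (dLamc ht) (dLams ht)).2.
have X0 : X 0 = laplace1 ec 0 by rewrite /X !mulr0 expR0 cos0 sin0; ring.
have Y0 : Y 0 = laplace1 es 0 by rewrite /Y !mulr0 expR0 cos0 sin0; ring.
rewrite -X0 -Y0 -hX -hY /X /Y /c /d expRN.
have := cos2Dsin2 (be * s); have : expR (al * s) != 0 by rewrite gt_eqF ?expR_gt0.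
move: (expR _) (cos _) (sin _) (laplace1 ec s) (laplace1 es s) => e C S L M e0 CS.
split.
  transitivity ((C ^+ 2 + S ^+ 2) * L); first by rewrite CS mul1r.
  by field.
transitivity ((C ^+ 2 + S ^+ 2) * M); first by rewrite CS mul1r.
by field.
Qed.
End LaplaceBessel.

(** * Lerch's theorem *)

Section Lerch.
Context {R : realType}.
Local Notation mu := (@lebesgue_measure R).
Local Notation D := (@Rpos R).
Local Notation integ f := (mu.-integrable D (EFin \o f)).
Local Notation I f := (\int[mu]_(t in D) f t)%R.

Lemma Bernoulli_le (x : R) (N : nat) : 0 <= x <= 1 -> 1 - N%:R * x <= (1 - x) ^+ N.
Proof.
move=> /andP[x0 x1]; elim: N => [|N IH]; first by rewrite mul0r subr0 expr0.
rewrite exprS; apply: (@le_trans _ _ ((1 - x) * (1 - N%:R * x))).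
  rewrite -natr1; have : 0 <= N%:R * (x * x) by rewrite !mulr_ge0.
  by nra.
by rewrite ler_wpM2l// subr_ge0.
Qed.

Lemma expr_one_sub_le (x : R) (N : nat) : x <= 1 -> (1 - x) ^+ N <= expR (- (N%:R * x)).
Proof.
move=> x1; rewrite -mulNr mulrC mulrN -mulNr expRM_natr.
by rewrite lerXn2r ?nnegrE ?subr_ge0 ?expR_ge0// expR_ge1Dx.
Qed.

(* Polynomials in [exp(-t)] that converge boundedly to the indicator of ]a, oo[. *)
Definition step (a : R) (n : nat) (t : R) : R :=
  (1 - expR (- (n%:R * t))) ^+ Num.truncn (n%:R * expR (n%:R * a)).

Lemma expRN_in01 (x : R) : 0 <= x -> 0 <= expR (- x) <= 1.
Proof. by move=> x0; rewrite expR_ge0 -expR0 ler_expR oppr_le0. Qed.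

Lemma step_in01 a n t : 0 <= t -> 0 <= step a n t <= 1.
Proof.
move=> t0; have /andP[h1 h2] := @expRN_in01 (n%:R * t) (mulr_ge0 (ler0n _ _) t0).
by rewrite /step exprn_ge0 ?subr_ge0//= exprn_ile1 ?subr_ge0// gerBl.
Qed.

(** The exponent N satisfies N e^(-nt) >= n - 1, so [step] is at most e^(1 - n). The factor n in N
    is what makes this work up to t = a included. *)
Lemma cvg_step_le a t : 0 <= t <= a -> step a n t @[n --> \oo] --> 0.
Proof.
move=> /andP[t0 ta].
apply: (@squeeze_cvgr _ _ _ _ (fun=> 0) (fun n => expR 1 * expR (- (1 * n%:R)))).
- near=> n; have /andP[-> _] := step_in01 a n t0 => /=.
  have /andP[h1 h2] := @expRN_in01 (n%:R * t) (mulr_ge0 (ler0n _ _) t0).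
  apply: le_trans (expr_one_sub_le _ h2) _; rewrite -expRD ler_expR.
  have hN := truncnS_gt (n%:R * expR (n%:R * a)).
  set N := Num.truncn _ in hN *.
  have h3 : (n%:R - 1) <= N%:R * expR (- (n%:R * t)).
    have e1 : expR (n%:R * a) * expR (- (n%:R * t)) >= 1.
      by rewrite -expRD -expR0 ler_expR -mulrBr mulr_ge0// subr_ge0.
    have e2 : n%:R * expR (n%:R * a) - 1 <= N%:R by rewrite lerBlDr natr1 ltW.
    apply: (@le_trans _ _ ((n%:R * expR (n%:R * a) - 1) * expR (- (n%:R * t)))); last first.
      by rewrite ler_wpM2r.
    rewrite mulrBl mul1r -mulrA lerB//.
    by rewrite ler_peMr.
  by rewrite mul1r; lra.
- exact: cvg_cst.
- rewrite -[X in _ --> X](mulr0 (expR 1)); apply: cvgMl_tmp.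
  exact: cvg_expRN.
Unshelve. all: by end_near. Qed.

Lemma cvg_step_gt a t : 0 <= a < t -> step a n t @[n --> \oo] --> (1 : R).
Proof.
move=> /andP[a0 at_]; have t0 : 0 <= t by rewrite (le_trans a0)// ltW.
(* By Bernoulli's inequality the defect from 1 is at most N e^(-nt) <= n e^(-2dn); one factor
   e^(-dn) absorbs n. *)
pose d := (t - a) / 2; have d0 : 0 < d by rewrite divr_gt0// subr_gt0.
apply: (@squeeze_cvgr _ _ _ _ (fun n => 1 - d^-1 * expR (- (d * n%:R))) (fun=> 1)).
- near=> n; have /andP[_ ->] := step_in01 a n t0; rewrite andbT.
  have h := @expRN_in01 (n%:R * t) (mulr_ge0 (ler0n _ _) t0).
  apply: le_trans (Bernoulli_le _ h); rewrite lerB//.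
  have hN : (Num.truncn (n%:R * expR (n%:R * a)))%:R <= n%:R * expR (n%:R * a).
    by rewrite truncn_le mulr_ge0// expR_ge0.
  apply: le_trans (ler_wpM2r (expR_ge0 _) hN) _.
  rewrite -mulrA -expRD.
  apply: le_trans (ler_wpM2r (expR_ge0 _) (le_expR_inv _ d0)) _.
  rewrite -[leLHS]mulrA -expRD; apply: ler_wpM2l; first by rewrite invr_ge0 ltW.
  rewrite ler_expR.
  by rewrite /d le_eqVlt; apply/orP; left; apply/eqP; field.
- rewrite -[X in _ --> X]subr0; apply: cvgB; first exact: cvg_cst.
  rewrite -[X in _ --> X](mulr0 d^-1); apply: cvgMl_tmp.
  exact: cvg_expRN.
- exact: cvg_cst.
Unshelve. all: by end_near. Qed.

Lemma measurable_expRN (c : R) : measurable_fun D (fun t : R => expR (- (c * t))).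
Proof.
apply: measurable_continuous => t; apply: (continuous_is_derive (df := - c * expR (- (c * t)))).
by apply: is_derive_eq; rewrite /GRing.scale/=; ring.
Qed.

Lemma measurable_step a n : measurable_fun D (step a n).
Proof.
by apply: measurable_funX; apply: measurable_funB => //; exact: measurable_expRN.
Qed.

Variable f : R -> R.
Hypothesis fi : integ f.
Hypothesis f0 : forall n, I (fun t => expR (- (n%:R * t)) * f t) = 0.

(** The factor e^(-kt) strengthens the statement for the induction on N: a further 1 - e^(-nt) gives
    the difference of the cases k and k + n. *)
Let moment_poly (n N k : nat) :
  integ (fun t => (1 - expR (- (n%:R * t))) ^+ N * (expR (- (k%:R * t)) * f t)) /\
  I (fun t => (1 - expR (- (n%:R * t))) ^+ N * (expR (- (k%:R * t)) * f t)) = 0.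
Proof.
elim: N k => [|N IH] k.
  have i k' : integ (fun t => expR (- (k'%:R * t)) * f t).
    apply: (integ_mulb (C := 1) fi); first exact: measurable_expRN.
    move=> t t0; have /andP[h1 h2] := @expRN_in01 (k'%:R * t) (mulr_ge0 (ler0n _ _) (ltW t0)).
    by rewrite ger0_norm.
  have e t : expR (- (k%:R * t)) * f t = (1 - expR (- (n%:R * t))) ^+ 0 * (expR (- (k%:R * t)) * f t).
    by rewrite expr0 mul1r.
  split; first exact: integ_ext (fun t _ => e t) (i k).
  by rewrite -(eq_Rint mu (fun t _ => e t)).
have [i1 e1] := IH k; have [i2 e2] := IH (k + n)%N.
have E t : (1 - expR (- (n%:R * t))) ^+ N * (expR (- (k%:R * t)) * f t) -
   (1 - expR (- (n%:R * t))) ^+ N * (expR (- ((k + n)%N%:R * t)) * f t) =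
   (1 - expR (- (n%:R * t))) ^+ N.+1 * (expR (- (k%:R * t)) * f t).
  by rewrite natrD mulrDl opprD expRD exprS; ring.
split; first exact: integ_ext (fun t _ => E t) (integB i1 i2).
by rewrite -(eq_Rint mu (fun t _ => E t)) RintB// e1 e2 subrr.
Qed.

Let tail0 a : 0 <= a -> I (fun t => \1_(`]a, +oo[%classic) t * f t) = 0.
Proof.
move=> a0.
have h1 : I (fun t => step a n t * f t) @[n --> \oo] -->
    I (fun t => \1_(`]a, +oo[%classic) t * f t).
  apply: (Rint_dominated (g := fun t => `|f t|)).
  - by move=> n; apply: measurable_funM; [exact: measurable_step|exact: integ_meas fi].
  - apply: measurable_funM; last exact: integ_meas fi.
    by apply: measurable_funTS; apply: measurable_indic; exact: measurable_itv.
  - exact: integ_norm.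
  - move=> t t0; apply: cvgMr_tmp; rewrite indicE.
    have [ta|at_] := leP t a.
      rewrite memNset; first by apply: cvg_step_le; rewrite ltW.
      by rewrite /= in_itv/= andbT; apply/negP; rewrite -leNgt.
    rewrite mem_set; first by apply: cvg_step_gt; rewrite a0.
    by rewrite /= in_itv/= andbT.
  - move=> n t t0; have /andP[s0 s1] := step_in01 a n (ltW t0).
    by rewrite normrM ler_piMl// ger0_norm.
have h2 n : I (fun t => step a n t * f t) = 0.
  have [_ <-] := moment_poly n (Num.truncn (n%:R * expR (n%:R * a))) 0.
  by apply: eq_Rint => t _; rewrite mul0r oppr0 expR0 mul1r.
have h3 : I (fun t => step a n t * f t) @[n --> \oo] --> 0.
  by apply: cvg_near_cst; apply: nearW => n; exact: h2.
exact: (cvg_unique _ h1 h3).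
Qed.

(** The tails and the total integral vanish, so the primitive of [f] extended by 0 is identically
    zero; Lebesgue differentiation then gives [f] almost everywhere. *)
Lemma Lerch : {ae mu, forall t, D t -> f t = 0}.
Proof.
pose f1 := f \_ D.
have i1 : mu.-integrable [set: R] (EFin \o f1).
  have := (iffLR (integrable_mkcond _ measurable_Rpos) fi).
  by rewrite restrict_EFin.
have i2 y : mu.-integrable `]-oo, y] (EFin \o f1).
  by apply: integrableS i1 => //; exact: measurable_itv.
have F0 : (fun x => \int[mu]_(t in `]-oo, x]) f1 t)%R = (fun=> 0).
  apply/funext => x; rewrite -Rintegral_mkcondr setIC Rintegral_mkcondr.
  have [x0|x0] := leP 0 x; last first.
    rewrite (@eq_Rint _ _ _ (fun=> 0)) ?Rintegral_cst ?mul0r//; first exact: measurable_Rpos.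
    move=> t t0; rewrite patchE memNset//= in_itv/=; apply/negP.
    by rewrite -ltNge (lt_trans x0).
  have h := tail0 x0.
  have hT : I f = 0.
    rewrite -(f0 0); apply: eq_Rint => t _.
    by rewrite mul0r oppr0 expR0 mul1r.
  have ii : integ (fun t => \1_(`]x, +oo[%classic) t * f t).
    apply: (integ_mulb (C := 1) fi).
      by apply: measurable_funTS; apply: measurable_indic; exact: measurable_itv.
    by move=> t _; rewrite indicE; case: (_ \in _); rewrite ?normr1 ?normr0.
  rewrite -[RHS](subrr (0 : R)) -{1}hT -{1}h -RintB//.
  apply: eq_Rint => t t0; rewrite patchE indicE.
  have [tx|xt] := leP t x.
    rewrite mem_set ?memNset ?mul0r ?subr0//=; rewrite in_itv/= ?andbT//.
    by apply/negP; rewrite -leNgt.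
  rewrite memNset ?mem_set ?mul1r ?subrr//=; rewrite in_itv/= ?andbT//.
  by apply/negP; rewrite -ltNge.
have lf : locally_integrable [set: R] f1.
  exact: integrable_locally measurable_Rpos fi.
have := FTC1Ny i2 lf; rewrite /= F0.
apply: (@filterS _ _ (ae_filter_ringOfSetsType mu)) => t [_ h]; rewrite RposE => t0; move: h.
by rewrite derive1_cst /f1 patchE mem_set// RposE.
Qed.

End Lerch.

(** * Symmetry of the Bessel kernel operator *)

Section BesselKernel.
Context {R : realType}.
Local Notation D := (@Rpos R).
Local Notation m := (@m_meas R).
Local Notation integ f := (m.-integrable D (EFin \o f)).
Local Notation I f := (\int[m]_(t in D) f t)%R.
Local Notation TR := (measurableTypeR R).
Implicit Types (p u : R -> R).

Lemma measurable_besselg_scale n t : measurable_fun D (fun s : R => besselg n (s * t)).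
Proof.
apply: measurable_continuous => s.
have -> : (fun s => besselg n (s * t)) = (fun s => besselg n (t * s)).
  by apply/funext => r; rewrite mulrC.
exact: continuous_besselg_comp.
Qed.

Lemma integ_bessel u t : 0 < t -> integ u -> integ (fun s => besselg 1 (s * t) * u s).
Proof.
move=> t0 hu; apply: (integ_mulb (C := 1) hu); first exact: measurable_besselg_scale.
by move=> s s0; apply: besselg_le1; rewrite mulr_ge0// ltW.
Qed.

(** K on real functions; [opK] is this operator on the real and imaginary parts. *)
Definition besselK u t := I (fun s => besselg 1 (s * t) * u s).

Lemma besselK_le u t : 0 < t -> integ u -> `|besselK u t| <= I (fun s => `|u s|).
Proof.
move=> t0 hu; apply: Rint_norm_le; [exact: integ_bessel|exact: integ_norm|].
move=> s s0; rewrite normrM ler_piMl//.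
by apply: besselg_le1; rewrite mulr_ge0// ltW.
Qed.

Let measurable_patch u : integ u -> measurable_fun [set: TR] (u \_ D : TR -> R).
Proof.
move=> hu; apply/(measurable_restrict _ measurable_Rpos measurableT).
by rewrite setTI; exact: integ_meas hu.
Qed.

(** With z = (t, s), extended by 0 so that Fubini's theorem is applied on the whole plane. *)
Let ker p u (z : TR * TR) : \bar R :=
  ((p \_ D) z.1 * (besselg 1 (z.2 * z.1) * (u \_ D) z.2))%:E.

Let measurable_ker p u : integ p -> integ u -> measurable_fun [set: TR * TR] (ker p u).
Proof.
move=> hp hu; apply/measurable_EFinP; apply: measurable_funM.
  apply: (measurableT_comp (measurable_patch hp)); exact: measurable_fst.
apply: measurable_funM; last first.
  apply: (measurableT_comp (measurable_patch hu)); exact: measurable_snd.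
apply: (measurableT_comp (measurable_besselg 1)).
by apply: measurable_funM; [exact: measurable_snd|exact: measurable_fst].
Qed.

Let kerE p u t : integ u ->
  (\int[m]_s ker p u (t, s) = ((p \_ D) t * besselK u t)%:E)%E.
Proof.
move=> hu; have [Dt|nDt] := boolP (t \in D); last first.
  rewrite patchE (negPf nDt) mul0r.
  apply: integral0_eq => s _.
  by rewrite /ker/= patchE (negPf nDt) mul0r.
have t0 : 0 < t by move: Dt; rewrite inE RposE.
rewrite /besselK EFinM /Rintegral fineK; last first.
  exact: (integrable_fin_num measurable_Rpos (integ_bessel t0 hu)).
rewrite -(integralZl measurable_Rpos (integ_bessel t0 hu)).
rewrite [RHS]integral_mkcond; apply: eq_integral => s _.
rewrite /ker /= !patchE Dt; case: ifPn => //=.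
by move=> _; rewrite (_ : point = 0 :> R)// !mulr0.
Qed.

Let ker_swap p u z : ker p u z = ker u p (z.2, z.1).
Proof.
rewrite /ker/= (mulrC z.1) mulrCA; congr (_%:E); ring.
Qed.

(** Because |g| <= 1 on the half-line, |p(t)| |u(s)| dominates the kernel. *)
Let integrable_ker p u : integ p -> integ u ->
  (m \x m)%E.-integrable [set: TR * TR] (ker p u).
Proof.
move=> hp hu; apply/(integrable12ltyP _ _ (measurable_ker hp hu)).
have hnu := integ_norm hu; have hnp := integ_norm hp.
apply: (@le_lt_trans _ _ (\int[m]_(t in D) (`|p t| * I (fun s => `|u s|))%:E)%E); last first.
  have := integZ (I (fun s => `|u s|)) hnp.
  move=> /(integrable_lty measurable_Rpos); apply: le_lt_trans.
  by rewrite le_eqVlt; apply/orP; left; apply/eqP; apply: eq_integral => t _ /=; rewrite mulrC.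
rewrite [leRHS]integral_mkcond; apply: ge0_le_integral => //=.
- by move=> t _; apply: integral_ge0.
- apply: (@measurable_fun_fubini_tonelli_F _ _ TR TR R m (abse \o ker p u)) => //=.
  by apply: measurableT_comp => //; exact: measurable_ker.
- apply/(measurable_restrict _ measurable_Rpos measurableT).
  rewrite setTI; apply/measurable_EFinP; apply: measurable_funM => //.
  exact: integ_meas hnp.
move=> t _; rewrite [leRHS]patchE; case: ifPn => Dt; last first.
  rewrite integral0_eq// => s _; rewrite /ker/= patchE (negPf Dt) mul0r.
  by rewrite normr0.
have t0 : 0 < t by move: Dt; rewrite inE RposE.
rewrite EFinM /Rintegral fineK; last first.
  exact: (integrable_fin_num measurable_Rpos hnu).
rewrite -(integralZl measurable_Rpos hnu) [leRHS]integral_mkcond.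
apply: ge0_le_integral => //=.
- apply/measurable_EFinP; apply: measurableT_comp => //.
  apply: measurable_funM; first exact: measurable_cst.
  apply: measurable_funM; last exact: measurable_patch.
  by apply: (measurableT_comp (measurable_besselg 1)); exact: mulrr_measurable.
- apply/(measurable_restrict _ measurable_Rpos measurableT).
  by rewrite setTI; apply/measurable_EFinP; apply: integ_meas (integZ `|p t| hnu).
- move=> s _; rewrite /ker /= !patchE Dt; case: ifPn => Ds; last first.
    by rewrite (_ : point = 0 :> R)// !mulr0 normr0.
  have s0 : 0 < s by move: Ds; rewrite inE RposE.
  rewrite /= -EFinM lee_fin !normrM ler_wpM2l// ler_piMl//.
  by apply: besselg_le1; rewrite mulr_ge0// ltW.
Qed.

(** Fubini's theorem includes the measurability of partial integrals; here p = 1, integrable because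
    m is finite. *)
Lemma measurable_besselK u : integ u -> measurable_fun D (besselK u).
Proof.
move=> hu; have h1 := integ_m_cst (1 : R).
have /(measurable_funS measurableT (@subsetT _ D)) :=
  measurable_fubini_F (integrable_ker h1 hu).
move=> h; apply/measurable_EFinP; apply: eq_measurable_fun h => t Dt.
by rewrite /fubini_F kerE//= patchE Dt mul1r.
Qed.

Lemma besselK_sym p u : integ p -> integ u ->
  I (fun t => p t * besselK u t) = I (fun s => u s * besselK p s).
Proof.
move=> hp hu; have := Fubini (integrable_ker hp hu).
under eq_integral do rewrite kerE//.
under [RHS]eq_integral do under eq_integral do rewrite ker_swap.
under [RHS]eq_integral do rewrite kerE//.
have E (f g : R -> R) : (\int[m]_t ((f \_ D) t * g t)%:E = \int[m]_(t in D) (f t * g t)%:E)%E.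
  rewrite [RHS]integral_mkcond; apply: eq_integral => t _.
  by rewrite !patchE; case: ifPn => // _; rewrite (_ : point = 0 :> R)// mul0r.
by rewrite !E /Rintegral => ->.
Qed.
End BesselKernel.

(** * Complex-valued functions and L_2(m) *)

Section ComplexIntegral.
Context {R : realType}.
Local Notation C := R[i].
Local Notation D := (@Rpos R).
Local Notation m := (@m_meas R).
Local Notation integ f := (m.-integrable D (EFin \o f)).
Local Notation I f := (\int[m]_(t in D) f t)%R.
Local Notation Re := (@complex.Re R).
Local Notation Im := (@complex.Im R).
Implicit Types (x y z : C) (F G phi : R -> C).

Lemma CReD x y : Re (x + y) = Re x + Re y. Proof. by case: x; case: y. Qed.
Lemma CImD x y : Im (x + y) = Im x + Im y. Proof. by case: x; case: y. Qed.
Lemma CReN x : Re (- x) = - Re x. Proof. by case: x. Qed.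
Lemma CImN x : Im (- x) = - Im x. Proof. by case: x. Qed.
Lemma CReB x y : Re (x - y) = Re x - Re y. Proof. by rewrite CReD CReN. Qed.
Lemma CImB x y : Im (x - y) = Im x - Im y. Proof. by rewrite CImD CImN. Qed.
Lemma CReM x y : Re (x * y) = Re x * Re y - Im x * Im y.
Proof. by case: x; case: y. Qed.
Lemma CImM x y : Im (x * y) = Re x * Im y + Im x * Re y.
Proof. by case: x; case: y. Qed.
Lemma CReC (r : R) : Re r%:C = r. Proof. by []. Qed.
Lemma CImC (r : R) : Im r%:C = 0. Proof. by []. Qed.
Lemma CReCM (r : R) x : Re (r%:C * x) = r * Re x.
Proof. by rewrite CReM CReC CImC mul0r subr0. Qed.
Lemma CImCM (r : R) x : Im (r%:C * x) = r * Im x.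
Proof. by rewrite CImM CReC CImC mul0r addr0. Qed.
Definition CReImE := (CReCM, CImCM, CReB, CImB, CReD, CImD, CReN, CImN, CReM, CImM, CReC, CImC).

Lemma eq_ReIm x y : Re x = Re y -> Im x = Im y -> x = y.
Proof. by case: x => a b; case: y => c d /= -> ->. Qed.

(* Unlike the modulus, this norm is compatible with componentwise integration at once;
   it is submultiplicative too. *)
Definition cn x : R := `|Re x| + `|Im x|.

Lemma cn_ge0 x : 0 <= cn x. Proof. by rewrite addr_ge0. Qed.
Lemma cnN x : cn (- x) = cn x. Proof. by rewrite /cn CReN CImN !normrN. Qed.
Lemma cnC (r : R) : cn r%:C = `|r|. Proof. by rewrite /cn normr0 addr0. Qed.
Lemma cn0 : cn 0 = 0. Proof. by rewrite /cn normr0 addr0. Qed.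
Lemma cnD x y : cn (x + y) <= cn x + cn y.
Proof. by rewrite /cn CReD CImD addrACA lerD ?ler_normD. Qed.
Lemma cnB x y : cn (x - y) <= cn x + cn y.
Proof. by rewrite -(cnN y) cnD. Qed.
Lemma cnM x y : cn (x * y) <= cn x * cn y.
Proof.
rewrite /cn CReM CImM mulrDl !mulrDr -!normrM.
have h1 := ler_normB (Re x * Re y) (Im x * Im y).
have h2 := ler_normD (Re x * Im y) (Im x * Re y).
by lra.
Qed.
Lemma cnCM (r : R) x : cn (r%:C * x) = `|r| * cn x.
Proof. by rewrite /cn CReCM CImCM !normrM mulrDr. Qed.
Lemma cn_eq0 x : cn x = 0 -> x = 0.
Proof.
move=> /eqP; rewrite /cn paddr_eq0// !normr_eq0 => /andP[/eqP h1 /eqP h2].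
exact: eq_ReIm.
Qed.
Lemma norm_Re_le x : `|Re x| <= cn x. Proof. by rewrite lerDl. Qed.
Lemma norm_Im_le x : `|Im x| <= cn x. Proof. by rewrite lerDr. Qed.

Definition Cmeas F := measurable_fun D (fun t => Re (F t)) /\
  measurable_fun D (fun t => Im (F t)).

Lemma Cmeas_ext F G : (forall t, 0 < t -> F t = G t) -> Cmeas F -> Cmeas G.
Proof.
move=> FG [h1 h2]; split.
  by apply: eq_measurable_fun h1 => t /[!inE]; rewrite RposE => /FG ->.
by apply: eq_measurable_fun h2 => t /[!inE]; rewrite RposE => /FG ->.
Qed.

Lemma CmeasD F G : Cmeas F -> Cmeas G -> Cmeas (fun t => F t + G t).
Proof.
move=> [f1 f2] [g1 g2]; split.
  by under eq_fun do rewrite CReD; apply: measurable_funD.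
by under eq_fun do rewrite CImD; apply: measurable_funD.
Qed.

Lemma CmeasM F G : Cmeas F -> Cmeas G -> Cmeas (fun t => F t * G t).
Proof.
move=> [f1 f2] [g1 g2]; split.
  by under eq_fun do rewrite CReM; apply: measurable_funB; apply: measurable_funM.
by under eq_fun do rewrite CImM; apply: measurable_funD; apply: measurable_funM.
Qed.

Lemma Cmeas_cst x : Cmeas (fun=> x).
Proof. by split; exact: measurable_cst. Qed.

Lemma CmeasC (f : R -> R) : measurable_fun D f -> Cmeas (fun t => (f t)%:C).
Proof. by move=> hf; split => //; exact: measurable_cst. Qed.

Lemma CmeasN F : Cmeas F -> Cmeas (fun t => - F t).
Proof.
move=> /(CmeasM (Cmeas_cst (-1))); apply: Cmeas_ext => t _.
by rewrite mulN1r.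
Qed.

Lemma CmeasB F G : Cmeas F -> Cmeas G -> Cmeas (fun t => F t - G t).
Proof. by move=> hF hG; apply: CmeasD => //; exact: CmeasN. Qed.

Lemma Cmeas_sum (J : Type) (r : seq J) (H : J -> R -> C) :
  (forall j, Cmeas (H j)) -> Cmeas (fun t => \sum_(j <- r) H j t).
Proof.
move=> hH; elim: r => [|j r IH].
  by apply: Cmeas_ext (Cmeas_cst 0) => t _; rewrite big_nil.
by apply: Cmeas_ext (CmeasD (hH j) IH) => t _; rewrite big_cons.
Qed.

Lemma Cmeas_cn F : Cmeas F -> measurable_fun D (fun t => cn (F t)).
Proof.
by move=> [h1 h2]; apply: measurable_funD; apply: measurableT_comp.
Qed.

Definition Cinteg F := integ (fun t => Re (F t)) /\ integ (fun t => Im (F t)).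

Lemma Cinteg_meas F : Cinteg F -> Cmeas F.
Proof. by move=> [h1 h2]; split; [exact: integ_meas h1|exact: integ_meas h2]. Qed.

Lemma Cinteg_ext F G : (forall t, 0 < t -> F t = G t) -> Cinteg F -> Cinteg G.
Proof.
move=> FG [h1 h2]; split.
  by apply: integ_ext h1 => t /FG ->.
by apply: integ_ext h2 => t /FG ->.
Qed.

Lemma Cinteg_dom F (g : R -> R) : Cmeas F -> (forall t, 0 < t -> cn (F t) <= g t) ->
  integ g -> Cinteg F.
Proof.
move=> [h1 h2] h hg; split.
  by apply: integ_dom hg => // t t0; apply: le_trans (norm_Re_le _) (h _ t0).
by apply: integ_dom hg => // t t0; apply: le_trans (norm_Im_le _) (h _ t0).
Qed.

Lemma Cinteg_cn F : Cinteg F -> integ (fun t => cn (F t)).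
Proof. by move=> [/integ_norm h1 /integ_norm h2]; exact: integD. Qed.

Lemma CintegD F G : Cinteg F -> Cinteg G -> Cinteg (fun t => F t + G t).
Proof.
move=> [f1 f2] [g1 g2]; split.
  by apply: integ_ext (integD f1 g1) => t _; rewrite CReD.
by apply: integ_ext (integD f2 g2) => t _; rewrite CImD.
Qed.

Lemma CintegZ x F : Cinteg F -> Cinteg (fun t => x * F t).
Proof.
move=> hF; apply: (@Cinteg_dom _ (fun t => cn x * cn (F t))).
- by apply: CmeasM; [exact: Cmeas_cst|exact: Cinteg_meas].
- by move=> t _; exact: cnM.
- by apply: integZ; exact: Cinteg_cn.
Qed.

Lemma CintD F G : Cinteg F -> Cinteg G ->
  Cintegral_m (fun t => F t + G t) = Cintegral_m F + Cintegral_m G.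
Proof.
move=> [f1 f2] [g1 g2]; apply: eq_ReIm; rewrite ?CReD ?CImD /Cintegral_m/=.
  by rewrite -RintD//; apply: eq_Rint => t _; rewrite CReD.
by rewrite -RintD//; apply: eq_Rint => t _; rewrite CImD.
Qed.

Lemma CintZ x F : Cinteg F -> Cintegral_m (fun t => x * F t) = x * Cintegral_m F.
Proof.
move=> [f1 f2]; apply: eq_ReIm; rewrite ?CReM ?CImM /Cintegral_m/=.
  rewrite -!RintZ// -RintB; [|exact: integZ..].
  by apply: eq_Rint => t _; rewrite CReM.
rewrite -!RintZ// -RintD; [|exact: integZ..].
by apply: eq_Rint => t _; rewrite CImM.
Qed.

Lemma CintB F G : Cinteg F -> Cinteg G ->
  Cintegral_m (fun t => F t - G t) = Cintegral_m F - Cintegral_m G.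
Proof.
move=> hF hG; rewrite -[in RHS](mulN1r (Cintegral_m G)) -CintZ// -CintD//; last exact: CintegZ.
by congr Cintegral_m; apply/funext => t; rewrite mulN1r.
Qed.

Lemma eq_Cint F G : (forall t, 0 < t -> F t = G t) -> Cintegral_m F = Cintegral_m G.
Proof.
move=> h; apply: eq_ReIm; rewrite /Cintegral_m/=.
  by apply: eq_Rint => t /h ->.
by apply: eq_Rint => t /h ->.
Qed.

Lemma Cint0 : Cintegral_m (fun=> 0 : C) = 0.
Proof.
by apply: eq_ReIm; rewrite /Cintegral_m/= Rintegral_cst ?mul0r//; exact: measurable_Rpos.
Qed.

Lemma Cint_ae F G : Cmeas F -> Cmeas G -> L2_eq F G -> Cintegral_m F = Cintegral_m G.
Proof.
move=> [f1 f2] [g1 g2] FG; apply: eq_ReIm; rewrite /Cintegral_m/= /Rintegral; congr fine.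
  apply: ae_eq_integral; [exact: measurable_Rpos|exact/measurable_EFinP..|].
  by apply: (@filterS _ _ (ae_filter_ringOfSetsType m)) FG => t h Dt; rewrite h.
apply: ae_eq_integral; [exact: measurable_Rpos|exact/measurable_EFinP..|].
by apply: (@filterS _ _ (ae_filter_ringOfSetsType m)) FG => t h Dt; rewrite h.
Qed.

Lemma cn_Cint_le F (g : R -> R) : Cmeas F -> integ g ->
  (forall t, 0 < t -> cn (F t) <= g t) -> cn (Cintegral_m F) <= I g.
Proof.
move=> mF hg h; have [f1 f2] := Cinteg_dom mF h hg.
have := @Rint_le _ m _ g (integD (integ_norm f1) (integ_norm f2)) hg h.
apply: le_trans; rewrite RintD; [|exact: integ_norm..].
by apply: lerD; apply: (le_normr_Rintegral measurable_Rpos).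
Qed.

Lemma Cint_sum (J : Type) (r : seq J) (H : J -> R -> C) : (forall j, Cinteg (H j)) ->
  Cinteg (fun t => \sum_(j <- r) H j t) /\
  Cintegral_m (fun t => \sum_(j <- r) H j t) = \sum_(j <- r) Cintegral_m (H j).
Proof.
move=> hH; elim: r => [|j r [IH1 IH2]].
  have e : (fun t : R => \sum_(j <- [::]) H j t) = (fun=> 0).
    by apply/funext => t; rewrite big_nil.
  rewrite e big_nil Cint0; split => //; split; exact: integ_m_cst.
have e : (fun t : R => \sum_(j0 <- j :: r) H j0 t) = (fun t => H j t + \sum_(j0 <- r) H j0 t).
  by apply/funext => t; rewrite big_cons.
by rewrite e big_cons CintD// IH2; split => //; exact: CintegD.
Qed.

(** The two squares are comparable: |z|^2 <= cn(z)^2 <= 2 |z|^2. *)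
Lemma L2P phi : L2 phi <-> Cmeas phi /\ integ (fun t => cn (phi t) ^+ 2).
Proof.
split=> [[h1 h2 h3]|[[h1 h2] h3]].
  split=> //.
  have i : integ (fun t => Re (phi t) ^+ 2 + Im (phi t) ^+ 2).
    apply/integrableP; split.
      by apply/measurable_EFinP; apply: measurable_funD; exact: measurable_funX.
    apply: le_lt_trans h3; rewrite le_eqVlt; apply/orP; left; apply/eqP.
    by apply: eq_integral => t _ /=; rewrite ger0_norm ?addr_ge0 ?sqr_ge0.
  apply: integ_dom (integZ 2 i).
    by apply: measurable_funX; exact: Cmeas_cn.
  move=> t _; rewrite ger0_norm ?sqr_ge0// /cn.
  rewrite -(real_normK (num_real (Re _))) -(real_normK (num_real (Im _))).
  have := sqr_ge0 (`|Re (phi t)| - `|Im (phi t)|); by nra.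
split=> //.
have i : integ (fun t => Re (phi t) ^+ 2 + Im (phi t) ^+ 2).
  apply: integ_dom h3.
    by apply: measurable_funD; exact: measurable_funX.
  move=> t _; rewrite ger0_norm ?addr_ge0 ?sqr_ge0// /cn.
  rewrite -(real_normK (num_real (Re _))) -(real_normK (num_real (Im _))).
  have : 0 <= `|Re (phi t)| * `|Im (phi t)| by rewrite mulr_ge0.
  by nra.
exact: (integrable_lty measurable_Rpos i).
Qed.

Lemma L2_meas phi : L2 phi -> Cmeas phi. Proof. by move=> /L2P[]. Qed.

Lemma L2_dom F (g : R -> R) : Cmeas F -> (forall t, 0 < t -> cn (F t) <= g t) ->
  integ (fun t => g t ^+ 2) -> L2 F.
Proof.
move=> mF h hg; apply/L2P; split => //; apply: integ_dom hg.
  by apply: measurable_funX; exact: Cmeas_cn.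
move=> t t0; rewrite ger0_norm ?sqr_ge0// lerXn2r ?nnegrE ?cn_ge0 ?h//.
exact: le_trans (cn_ge0 _) (h _ t0).
Qed.

Lemma L2_ext F G : (forall t, 0 < t -> F t = G t) -> L2 F -> L2 G.
Proof.
move=> FG /L2P[h1 h2]; apply/L2P; split; first exact: Cmeas_ext h1.
by apply: integ_ext h2 => t /FG ->.
Qed.

Lemma L2_mul F G (K : R) : Cmeas F -> (forall t, 0 < t -> cn (F t) <= K) -> L2 G ->
  L2 (fun t => F t * G t).
Proof.
move=> mF hF /L2P[mG iG]; apply: (@L2_dom _ (fun t => K * cn (G t))).
- exact: CmeasM.
- by move=> t t0; apply: le_trans (cnM _ _) _; rewrite ler_wpM2r ?cn_ge0 ?hF.
- by apply: integ_ext (integZ (K ^+ 2) iG) => t _; rewrite exprMn.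
Qed.

Lemma L2_scale x F : L2 F -> L2 (fun t => x * F t).
Proof. by apply: (@L2_mul (fun=> x) F (cn x)) => //; exact: Cmeas_cst. Qed.

Lemma L2_add F G : L2 F -> L2 G -> L2 (fun t => F t + G t).
Proof.
move=> /L2P[mF iF] /L2P[mG iG]; apply/L2P; split; first exact: CmeasD.
apply: integ_dom (integD (integZ 2 iF) (integZ 2 iG)).
  by apply: measurable_funX; apply: Cmeas_cn; exact: CmeasD.
move=> t t0; rewrite ger0_norm ?sqr_ge0//.
apply: (@le_trans _ _ ((cn (F t) + cn (G t)) ^+ 2)).
  by rewrite lerXn2r ?nnegrE ?addr_ge0 ?cn_ge0 ?cnD.
by have := sqr_ge0 (cn (F t) - cn (G t)); nra.
Qed.

Lemma L2_sub F G : L2 F -> L2 G -> L2 (fun t => F t - G t).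
Proof.
move=> hF hG; apply: L2_add => //.
by apply: L2_ext (L2_scale (-1) hG) => t _; rewrite mulN1r.
Qed.

Lemma L2_growth F (K c : R) : Cmeas F -> 2 * c < 1 ->
  (forall t, 0 < t -> cn (F t) <= K * expR (c * t)) -> L2 F.
Proof.
move=> mF hc h; apply: (@L2_dom _ (fun t => K * expR (c * t))) => //.
apply: integ_ext (integZ (K ^+ 2) (integ_m_expR hc)) => t _.
by rewrite exprMn -expRM_natr; congr (_ * expR _); ring.
Qed.

(* Cauchy-Schwarz: the weight e^(ct) with c < 1/2 is in L_2(m). *)
Lemma L2_Cinteg F phi (K c : R) : Cmeas F -> 2 * c < 1 ->
  (forall t, 0 < t -> cn (F t) <= K * expR (c * t)) -> L2 phi ->
  Cinteg (fun t => F t * phi t).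
Proof.
move=> mF hc h /L2P[mp ip].
apply: (@Cinteg_dom _ (fun t => K ^+ 2 * expR (2 * c * t) + cn (phi t) ^+ 2)).
- exact: CmeasM.
- move=> t t0; apply: le_trans (cnM _ _) _.
  apply: (@le_trans _ _ (K * expR (c * t) * cn (phi t))).
    by rewrite ler_wpM2r ?cn_ge0 ?h.
  have -> : K ^+ 2 * expR (2 * c * t) = (K * expR (c * t)) ^+ 2.
    by rewrite exprMn -expRM_natr; congr (_ * expR _); ring.
  move: (K * expR (c * t)) (cn (phi t)) => x y.
  by have := sqr_ge0 (x - y); have := sqr_ge0 x; have := sqr_ge0 y; nra.
- by apply: integD => //; apply: integZ; exact: integ_m_expR.
Qed.

Lemma L2_integ phi : L2 phi -> Cinteg phi.
Proof.
move=> hp; apply: Cinteg_ext (@L2_Cinteg (fun=> 1) phi 1 0 _ _ _ hp).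
- by move=> t _; rewrite mul1r.
- exact: Cmeas_cst.
- by rewrite mulr0.
- by move=> t _; rewrite mul0r expR0 mulr1 cnC normr1.
Qed.

Lemma L2_eq_trans F G H : L2_eq F G -> L2_eq G H -> L2_eq F H.
Proof. by apply: (@filterS2 _ _ (ae_filter_ringOfSetsType m)) => t h1 h2 Dt; rewrite h1// h2. Qed.

Lemma L2_eq_ext F G : (forall t, 0 < t -> F t = G t) -> L2_eq F G.
Proof. by move=> h; apply: aeW => t; rewrite RposE => /h. Qed.

End ComplexIntegral.

(** * The operator K on complex integrable functions *)

Section OperatorK.
Context {R : realType}.
Local Notation C := R[i].
Local Notation D := (@Rpos R).
Local Notation m := (@m_meas R).
Local Notation integ f := (m.-integrable D (EFin \o f)).
Local Notation I f := (\int[m]_(t in D) f t)%R.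
Local Notation Re := (@complex.Re R).
Local Notation Im := (@complex.Im R).
Implicit Types (x y z : C) (F G phi : R -> C).

Lemma opKE phi t : 0 < t -> opK phi t =
  Cintegral_m (fun s => (besselg 1 (s * t))%:C * phi s).
Proof.
by move=> t0; apply: eq_Cint => s s0; rewrite besselJ_sqrt// mulr_gt0.
Qed.

Lemma opK_ReIm phi t : 0 < t ->
  opK phi t = besselK (Re \o phi) t +i* besselK (Im \o phi) t.
Proof.
move=> t0; rewrite opKE//; apply: eq_ReIm; rewrite /Cintegral_m/=.
  by apply: eq_Rint => s _; rewrite CReCM.
by apply: eq_Rint => s _; rewrite CImCM.
Qed.

Lemma Cmeas_besselg phi t : Cmeas phi -> Cmeas (fun s => (besselg 1 (s * t))%:C * phi s).
Proof.
by move=> hp; apply: CmeasM => //; apply: CmeasC; exact: measurable_besselg_scale.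
Qed.

Lemma cn_besselg_le phi t s : 0 < t -> 0 < s ->
  cn ((besselg 1 (s * t))%:C * phi s) <= cn (phi s).
Proof.
move=> t0 s0; rewrite cnCM ler_piMl ?cn_ge0//.
by apply: besselg_le1; rewrite mulr_ge0// ltW.
Qed.

Lemma Cinteg_besselg phi t : 0 < t -> Cinteg phi ->
  Cinteg (fun s => (besselg 1 (s * t))%:C * phi s).
Proof.
move=> t0 hp; apply: Cinteg_dom (Cinteg_cn hp).
  by apply: Cmeas_besselg; exact: Cinteg_meas.
by move=> s s0; exact: cn_besselg_le.
Qed.

Lemma cn_opK_le phi t : 0 < t -> Cinteg phi -> cn (opK phi t) <= I (fun s => cn (phi s)).
Proof.
move=> t0 hp; rewrite opKE//; apply: cn_Cint_le.
- by apply: Cmeas_besselg; exact: Cinteg_meas.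
- exact: Cinteg_cn.
- by move=> s s0; exact: cn_besselg_le.
Qed.

Lemma Cmeas_opK phi : Cinteg phi -> Cmeas (opK phi).
Proof.
move=> [h1 h2].
apply: (@Cmeas_ext _ (fun t => besselK (Re \o phi) t +i* besselK (Im \o phi) t)).
  by move=> t t0; rewrite opK_ReIm.
by split => /=; exact: measurable_besselK.
Qed.

Lemma opKD F G t : 0 < t -> Cinteg F -> Cinteg G ->
  opK (fun s => F s + G s) t = opK F t + opK G t.
Proof.
move=> t0 hF hG; rewrite !opKE// -CintD; [|exact: Cinteg_besselg..].
by apply: eq_Cint => s _; rewrite mulrDr.
Qed.

Lemma opKZ x F t : 0 < t -> Cinteg F -> opK (fun s => x * F s) t = x * opK F t.
Proof.
move=> t0 hF; rewrite !opKE// -CintZ; last exact: Cinteg_besselg.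
by apply: eq_Cint => s _; rewrite mulrCA.
Qed.

Lemma opKB F G t : 0 < t -> Cinteg F -> Cinteg G ->
  opK (fun s => F s - G s) t = opK F t - opK G t.
Proof.
move=> t0 hF hG; rewrite !opKE// -CintB; [|exact: Cinteg_besselg..].
by apply: eq_Cint => s _; rewrite mulrBr.
Qed.

Lemma opK_ae F G t : 0 < t -> Cmeas F -> Cmeas G -> L2_eq F G -> opK F t = opK G t.
Proof.
move=> t0 mF mG FG; rewrite !opKE//; apply: Cint_ae; [exact: Cmeas_besselg..|].
by apply: (@filterS _ _ (ae_filter_ringOfSetsType m)) FG => s h Ds; rewrite h.
Qed.

Lemma L2_mul_opK (a : R -> C) (A : R) phi : Cmeas a -> (forall t, 0 < t -> cn (a t) <= A) ->
  Cinteg phi -> L2 (fun t => a t * opK phi t).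
Proof.
move=> ma hA hp; apply: L2_mul hA _ => //.
apply: (@L2_growth _ _ (I (fun s => cn (phi s))) 0).
- exact: Cmeas_opK.
- by rewrite mulr0.
- by move=> t t0; rewrite mul0r expR0 mulr1; exact: cn_opK_le.
Qed.

End OperatorK.

(** * The Fredholm alternative *)

Section GeometricSeries.
Context {R : realType}.
Implicit Types x : nat -> R.

Lemma geometric_cauchy x (M : R) : (forall n, `|x n.+1 - x n| <= M * 2^-1 ^+ n) ->
  exists l, x @ \oo --> l /\ forall n, `|l - x n| <= 2 * M * 2^-1 ^+ n.
Proof.
move=> h.
have M0 : 0 <= M by have := le_trans (normr_ge0 _) (h 0%N); rewrite expr0 mulr1.
(* The factor 1 - 2^-k is the exact partial geometric sum, which makes the bound inductive in k. *)
have hk n k : `|x (n + k)%N - x n| <= 2 * M * 2^-1 ^+ n * (1 - 2^-1 ^+ k).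
  elim: k => [|k IH]; first by rewrite addn0 !subrr normr0 mulr0.
  have -> : x (n + k.+1)%N - x n = (x (n + k).+1 - x (n + k)%N) + (x (n + k)%N - x n).
    by rewrite addnS; ring.
  apply: le_trans (ler_normD _ _) _; apply: le_trans (lerD (h _) IH) _.
  rewrite exprD exprS le_eqVlt; apply/orP; left; apply/eqP.
  by move: (2^-1 ^+ n) (2^-1 ^+ k) => p q; field.
have hk' n k : (n <= k)%N -> `|x k - x n| <= 2 * M * 2^-1 ^+ n.
  move=> nk; rewrite -(subnKC nk); apply: le_trans (hk _ _) _.
  have p0 i : 0 <= (2^-1 : R) ^+ i by rewrite exprn_ge0// invr_ge0.
  by rewrite ler_piMr ?gerBl// !mulr_ge0.
have c0 : 2 * M * 2^-1 ^+ n @[n --> \oo] --> (0 : R).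
  rewrite -[X in _ --> X](mulr0 (2 * M)); apply: cvgMl_tmp.
  apply: cvg_expr; rewrite ger0_norm//; lra.
have : cvgn x.
  apply/cauchy_cvgP/cauchy_exP => e e0.
  have /cvgrPdist_lt /(_ _ e0) [K _ hK] := c0.
  exists (x K); exists K => //= k Kk; rewrite -ball_normE/= distrC.
  apply: le_lt_trans (hk' _ _ Kk) _; have := hK K (leqnn _).
  by rewrite /= sub0r normrN; apply: le_lt_trans; exact: ler_norm.
move=> /cvg_ex[/= l xl]; exists l; split => // n.
have h1 : `|x k - x n| @[k --> \oo] --> `|l - x n|.
  by apply: cvg_norm; apply: cvgB => //; exact: cvg_cst.
apply: (ler_cvg_to h1 (cvg_cst (2 * M * 2^-1 ^+ n))).
near=> k; apply: hk'; near: k; exact: nbhs_infty_ge.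
Unshelve. all: by end_near. Qed.

End GeometricSeries.

Section KernelApprox.
Context {R : realType}.

Definition trunc_pow (N : R) (j : nat) (t : R) : R := t ^+ j * \1_(`]-oo, N]%classic) t.

Lemma trunc_powE N j t : trunc_pow N j t = if t <= N then t ^+ j else 0.
Proof.
rewrite /trunc_pow indicE; case: ifPn => h.
  by rewrite mem_set ?mulr1//= in_itv.
by rewrite memNset ?mulr0//= in_itv/=; exact/negP.
Qed.

Lemma trunc_pow_le N j t : 0 < t -> `|trunc_pow N j t| <= `|N| ^+ j.
Proof.
move=> t0; rewrite trunc_powE; case: ifPn => h; last by rewrite normr0 exprn_ge0.
rewrite normrX lerXn2r ?nnegrE// (ger0_norm (ltW t0)) (le_trans h)//.
exact: ler_norm.
Qed.

Lemma measurable_trunc_pow N j : measurable_fun (@Rpos R) (trunc_pow N j).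
Proof.
apply: measurable_funTS; apply: measurable_funM; first exact: exprn_measurable.
by apply: measurable_indic; exact: measurable_itv.
Qed.

(* The truncations make the remainder small in the weighted norm also where [s] or [t] is large,
   where only the boundedness of the kernel is available. *)
Lemma besselg_kernel_approx (eta : R) : 0 < eta -> exists N k, forall s t, 0 < s -> 0 < t ->
  `|besselg 1 (s * t) - \sum_(j < k) besselc 1 j * trunc_pow N j t * trunc_pow N j s| * expR (8^-1 * s)
    <= eta * expR (4^-1 * s) * expR (8^-1 * t).
Proof.
(* Beyond N, e^(t/8) >= t/8 >= 1/eta. *)
move=> eta0; pose N := 8 * eta^-1.
have N0 : 0 <= N by rewrite mulr_ge0// invr_ge0 ltW.
have NE t : N < t -> 1 <= eta * expR (8^-1 * t).
  move=> Nt; rewrite -ler_pdivrMl// mulr1.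
  apply: le_trans (expR_ge1Dx _); apply: le_trans (_ : 8^-1 * t <= _); last by rewrite lerDr.
  by rewrite ler_pdivlMl// ltW.
have e84 s : 0 < s -> expR (8^-1 * s) <= expR (4^-1 * s :> R).
  by move=> s0; rewrite ler_expR; apply: ler_wpM2r; [exact: ltW|lra].
have e1 (s : R) : 0 < s -> 1 <= expR (8^-1 * s).
  by move=> s0; rewrite -expR0 ler_expR mulr_ge0// ltW.
have [k hk] := besselg_approx 1 (N * N) eta0.
exists N, k => s t s0 t0.
(* If t > N or s > N the truncated sum is zero and |g| <= 1 is absorbed by eta e^(t/8), respectively
   by eta e^(s/8) with e^(s/4) = e^(s/8) e^(s/8). In the remaining square the sum is a Taylor
   polynomial of g at st, with st at most N^2. *)
have [tN|Nt] := leP t N; last first.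
  rewrite big1; last first.
    by move=> j _; rewrite [trunc_pow N j t]trunc_powE leNgt Nt/= mulr0 mul0r.
  rewrite subr0.
  apply: (@le_trans _ _ (1 * expR (8^-1 * s))).
    by rewrite ler_wpM2r ?expR_ge0// besselg_le1// mulr_ge0 ?ltW.
  rewrite mul1r mulrAC; apply: le_trans (e84 _ s0) _.
  by rewrite ler_peMl ?expR_ge0// NE.
have [sN|Ns] := leP s N; last first.
  rewrite big1; last first.
    by move=> j _; rewrite [trunc_pow N j s]trunc_powE leNgt Ns/= mulr0.
  rewrite subr0.
  apply: (@le_trans _ _ (1 * expR (8^-1 * s))).
    by rewrite ler_wpM2r ?expR_ge0// besselg_le1// mulr_ge0 ?ltW.
  rewrite mul1r; apply: (@le_trans _ _ (eta * expR (4^-1 * s))); last first.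
    by rewrite ler_peMr ?e1// mulr_ge0 ?expR_ge0// ltW.
  have -> : expR (4^-1 * s) = expR (8^-1 * s) * expR (8^-1 * s).
    by rewrite -expRD; congr expR; field.
  by rewrite mulrA ler_peMl ?expR_ge0// NE.
have st : `|s * t| <= N * N.
  by rewrite normrM !gtr0_norm// ler_pM// ltW.
have -> : \sum_(j < k) besselc 1 j * trunc_pow N j t * trunc_pow N j s = pseries (besselc 1) (s * t) k.
  rewrite /pseries /series/= big_mkord; apply: eq_bigr => j _.
  by rewrite !trunc_powE tN sN exprMn -mulrA (mulrC (t ^+ j)).
apply: le_trans (ler_wpM2r (expR_ge0 _) (hk _ st)) _.
rewrite -[leRHS]mulrA; apply: ler_wpM2l; first exact: ltW.
apply: le_trans (e84 _ s0) _.
by rewrite ler_peMr ?expR_ge0// e1.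
Qed.

End KernelApprox.

Section Fredholm.
Context {R : realType}.
Local Notation C := R[i].
Local Notation D := (@Rpos R).
Local Notation m := (@m_meas R).
Local Notation integ f := (m.-integrable D (EFin \o f)).
Local Notation I f := (\int[m]_(t in D) f t)%R.
Local Notation Re := (@complex.Re R).
Local Notation Im := (@complex.Im R).
Implicit Types (x y z : C) (u v phi : R -> C) (B : R).

(** A bound on the weighted sup norm of an actual function, imposed at every point, so that series
    of such functions can be summed pointwise. *)
Definition growth u B := Cmeas u /\ forall t, 0 < t -> cn (u t) <= B * expR (8^-1 * t).

Lemma growth_L2 u B : growth u B -> L2 u.
Proof. by move=> [mu hu]; apply: (L2_growth (K := B) (c := 8^-1)) => //; lra. Qed.

Lemma growth_integ u B : growth u B -> Cinteg u.
Proof. by move=> /growth_L2; exact: L2_integ. Qed.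

Lemma growth_ge0 u B : growth u B -> 0 <= B.
Proof.
move=> [_ /(_ 1 ltr01) h].
by rewrite -(pmulr_lge0 B (expR_gt0 (8^-1 * 1))); apply: le_trans (cn_ge0 _) h.
Qed.

Lemma growth_add u v B B' : growth u B -> growth v B' -> growth (fun t => u t + v t) (B + B').
Proof.
move=> [mu hu] [mv hv]; split; first exact: CmeasD.
by move=> t t0; apply: le_trans (cnD _ _) _; rewrite mulrDl lerD ?hu ?hv.
Qed.

Lemma growth_scale x u B : growth u B -> growth (fun t => x * u t) (cn x * B).
Proof.
move=> [mu hu]; split; first by apply: CmeasM => //; exact: Cmeas_cst.
by move=> t t0; apply: le_trans (cnM _ _) _; rewrite -mulrA ler_wpM2l ?cn_ge0 ?hu.
Qed.

Lemma growth_sum (J : Type) (r : seq J) (H : J -> R -> C) :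
  (forall j, exists B, growth (H j) B) -> exists B, growth (fun t => \sum_(j <- r) H j t) B.
Proof.
move=> h; elim: r => [|j r [B IH]].
  exists 0; split=> [|t _]; last by rewrite big_nil cn0 mul0r.
  by apply: Cmeas_ext (Cmeas_cst 0) => t _; rewrite big_nil.
have [B' h'] := h j; exists (B' + B); have [h1 h2] := growth_add h' IH; split.
  by apply: Cmeas_ext h1 => t _; rewrite big_cons.
by move=> t t0; rewrite big_cons; exact: h2.
Qed.

Variables (a : R -> C) (A : R).
Hypothesis ma : Cmeas a.
Hypothesis ha : forall t, 0 < t -> cn (a t) <= A.

(** This is K_z when a(t) = z (1 - e^(-t)) / (1 - z e^(-t)). *)
Definition opT u t := a t * opK u t.

Let A0 : 0 <= A.
Proof. exact: le_trans (cn_ge0 _) (ha ltr01). Qed.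

(** The gain of regularity that leads from L_2(m) into the weighted space. *)
Lemma growth_opT u : Cinteg u -> growth (opT u) (A * I (fun s => cn (u s))).
Proof.
move=> hu; split; first by apply: CmeasM => //; exact: Cmeas_opK.
move=> t t0; apply: le_trans (cnM _ _) _.
apply: (@le_trans _ _ (A * I (fun s => cn (u s)))).
  by rewrite ler_pM ?cn_ge0 ?ha ?cn_opK_le.
rewrite ler_peMr ?mulr_ge0//; first by apply: Rint_ge0 => s _; exact: cn_ge0.
by rewrite -expR0 ler_expR mulr_ge0// ltW.
Qed.

Section Decomposition.
Variables (N : R) (k : nat).

(** Each monomial (st)^j of the truncated kernel separates into a function of t, [rank1], and a
    linear functional in s, [trunc_moment]; [opS] is what remains of [opT]. *)
Definition rank1 (j : 'I_k) (t : R) : C := a t * (besselc 1 j * trunc_pow N j t)%:C.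
Definition trunc_moment (j : 'I_k) u : C := Cintegral_m (fun s => (trunc_pow N j s)%:C * u s).
Definition opS u t : C := opT u t - \sum_j trunc_moment j u * rank1 j t.

Lemma Cinteg_trunc_moment j u : Cinteg u -> Cinteg (fun s => (trunc_pow N j s)%:C * u s).
Proof.
move=> hu; apply: (@Cinteg_dom _ _ (fun s => `|N| ^+ j * cn (u s))).
- apply: CmeasM; last exact: Cinteg_meas.
  by apply: CmeasC; exact: measurable_trunc_pow.
- by move=> t t0; rewrite cnCM ler_wpM2r ?cn_ge0 ?trunc_pow_le.
- by apply: integZ; exact: Cinteg_cn.
Qed.

Lemma trunc_momentD j u v : Cinteg u -> Cinteg v ->
  trunc_moment j (fun t => u t + v t) = trunc_moment j u + trunc_moment j v.
Proof.
move=> hu hv; rewrite /trunc_moment -CintD; [|exact: Cinteg_trunc_moment..].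
by apply: eq_Cint => t _; rewrite mulrDr.
Qed.

Lemma trunc_momentZ j x u : Cinteg u -> trunc_moment j (fun t => x * u t) = x * trunc_moment j u.
Proof.
move=> hu; rewrite /trunc_moment -CintZ; last exact: Cinteg_trunc_moment.
by apply: eq_Cint => t _; rewrite mulrCA.
Qed.

Lemma trunc_moment_ae j u v : Cmeas u -> Cmeas v -> L2_eq u v -> trunc_moment j u = trunc_moment j v.
Proof.
move=> hu hv uv; have mt := CmeasC (measurable_trunc_pow N j).
apply: Cint_ae; [exact: CmeasM..|].
by apply: (@filterS _ _ (ae_filter_ringOfSetsType m)) uv => s h Ds; rewrite h.
Qed.

Lemma trunc_moment_sum (J : Type) (r : seq J) (H : J -> R -> C) j : (forall i, Cinteg (H i)) ->
  trunc_moment j (fun t => \sum_(i <- r) H i t) = \sum_(i <- r) trunc_moment j (H i).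
Proof.
move=> h; rewrite /trunc_moment -(Cint_sum r (fun i => Cinteg_trunc_moment j (h i))).2.
by apply: eq_Cint => t _; rewrite mulr_sumr.
Qed.

Lemma growth_rank1 j : exists B, growth (rank1 j) B.
Proof.
exists (A * (`|besselc 1 j| * `|N| ^+ j)); split.
  apply: CmeasM => //; apply: CmeasC; apply: measurable_funM; first exact: measurable_cst.
  exact: measurable_trunc_pow.
move=> t t0; apply: le_trans (cnM _ _) _; rewrite cnC normrM.
apply: (@le_trans _ _ (A * (`|besselc 1 j| * `|N| ^+ j))).
  by rewrite ler_pM ?cn_ge0 ?mulr_ge0 ?ha// ler_wpM2l// trunc_pow_le.
rewrite ler_peMr ?mulr_ge0 ?exprn_ge0//.
by rewrite -expR0 ler_expR mulr_ge0// ltW.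
Qed.

Let kap t s := besselg 1 (s * t) - \sum_(j < k) besselc 1 j * trunc_pow N j t * trunc_pow N j s.

Lemma opSE u t : 0 < t -> Cinteg u ->
  opS u t = a t * Cintegral_m (fun s => (kap t s)%:C * u s).
Proof.
move=> t0 hu.
pose H (j : 'I_k) s := (besselc 1 j * trunc_pow N j t)%:C * ((trunc_pow N j s)%:C * u s).
have iH j : Cinteg (H j) by apply: CintegZ; exact: Cinteg_trunc_moment.
have [iS eS] := Cint_sum (index_enum 'I_k) iH.
have -> : Cintegral_m (fun s => (kap t s)%:C * u s) =
    opK u t - \sum_j Cintegral_m (H j).
  rewrite -eS opKE// -CintB//; last exact: Cinteg_besselg.
  apply: eq_Cint => s _; rewrite /kap rmorphB mulrBl; congr (_ - _).
  rewrite rmorph_sum mulr_suml; apply: eq_bigr => j _.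
  by rewrite /H [X in X * _ = _]rmorphM mulrA.
rewrite mulrBr /opS /opT; congr (_ - _); rewrite mulr_sumr; apply: eq_bigr => j _.
rewrite /H CintZ; last exact: Cinteg_trunc_moment.
by rewrite -/(trunc_moment j u) /rank1 mulrCA [in RHS](mulrC _ (trunc_moment j u)).
Qed.

Variable eta : R.
Hypothesis hkap : forall s t, 0 < s -> 0 < t ->
  `|kap t s| * expR (8^-1 * s) <= eta * expR (4^-1 * s) * expR (8^-1 * t).
Hypothesis hA : A * eta * I (fun s => expR (4^-1 * s)) <= 2^-1.

Let i4 : integ (fun s => expR (4^-1 * s)).
Proof. by apply: integ_m_expR; lra. Qed.

(** By [hkap] the integrand is at most B eta e^(t/8) e^(s/4); integrating in s and using [hA] gives
    the ratio 1/2. *)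
Lemma growth_opS u B : growth u B -> growth (opS u) (2^-1 * B).
Proof.
move=> hu; have iu := growth_integ hu; split.
  apply: CmeasB; first by apply: CmeasM => //; exact: Cmeas_opK.
  apply: Cmeas_sum => j; apply: CmeasM; first exact: Cmeas_cst.
  by have [B' []] := growth_rank1 j.
move=> t t0; rewrite opSE//; apply: le_trans (cnM _ _) _.
have B0 := growth_ge0 hu; have [mu hu'] := hu.
have mk : measurable_fun D (kap t).
  apply: measurable_funB; first exact: measurable_besselg_scale.
  apply: measurable_sum => j; apply: measurable_funM; first exact: measurable_cst.
  exact: measurable_trunc_pow.
have h1 : cn (Cintegral_m (fun s => (kap t s)%:C * u s)) <=
    I (fun s => B * eta * expR (8^-1 * t) * expR (4^-1 * s)).
  apply: cn_Cint_le.
  - by apply: CmeasM => //; exact: CmeasC.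
  - by apply: integZ; exact: i4.
  - move=> s s0; rewrite cnCM.
    apply: le_trans (ler_wpM2l (normr_ge0 _) (hu' _ s0)) _.
    rewrite mulrCA; apply: le_trans (ler_wpM2l B0 (hkap s0 t0)) _.
    by rewrite le_eqVlt; apply/orP; left; apply/eqP; ring.
rewrite RintZ in h1; last exact: i4.
apply: le_trans (ler_pM (cn_ge0 _) (cn_ge0 _) (ha t0) h1) _.
have -> : A * (B * eta * expR (8^-1 * t) * I (fun s => expR (4^-1 * s))) =
   A * eta * I (fun s => expR (4^-1 * s)) * B * expR (8^-1 * t) by ring.
by rewrite ler_wpM2r ?expR_ge0// ler_wpM2r.
Qed.

Lemma opS_add u v t : 0 < t -> Cinteg u -> Cinteg v ->
  opS (fun s => u s + v s) t = opS u t + opS v t.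
Proof.
move=> t0 hu hv; rewrite /opS /opT opKD//.
under eq_bigr do rewrite trunc_momentD// mulrDl.
by rewrite big_split/=; ring.
Qed.

Lemma opS_scale x u t : 0 < t -> Cinteg u -> opS (fun s => x * u s) t = x * opS u t.
Proof.
move=> t0 hu; rewrite /opS /opT opKZ// mulrBr mulrCA; congr (_ - _).
rewrite mulr_sumr; apply: eq_bigr => j _.
by rewrite trunc_momentZ// -mulrA.
Qed.

Lemma Neumann v B : growth v B -> exists u B', growth u B' /\
  forall t, 0 < t -> u t - opS u t = v t.
Proof.
move=> hv; have B0 := growth_ge0 hv.
pose w n := iter n opS v.
have hw n : growth (w n) (B * 2^-1 ^+ n).
  elim: n => [|n IH]; first by rewrite expr0 mulr1.
  by have := growth_opS IH; rewrite exprS mulrCA.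
pose U n t := \sum_(i < n) w i t.
have US n t : U n.+1 t = U n t + w n t by rewrite /U big_ord_recr.
have hU n : exists B', growth (U n) B'.
  by apply: growth_sum => j; eexists; exact: hw.
have iU n : Cinteg (U n) by have [B' /growth_integ] := hU n.
have SU n t : 0 < t -> v t + opS (U n) t = U n.+1 t.
  move=> t0; elim: n => [|n IH].
    rewrite /U big_ord_recr big_ord0/= add0r.
    have -> : (fun t => \sum_(i < 0) w i t) = (fun s => 0 * v s).
      by apply/funext => s; rewrite big_ord0 mul0r.
    by rewrite opS_scale ?mul0r ?addr0//; exact: growth_integ hv.
  rewrite US -IH -addrA; congr (_ + _).
  have -> : U n.+1 = (fun s => U n s + w n s) by apply/funext => s; rewrite US.
  by rewrite opS_add//; exact: growth_integ (hw n).
(* One statement for the real and the imaginary part. Stating it for every t, with the dummy limit 0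
   when t <= 0, allows [choice] to produce total functions. *)
have lim_ (P : C -> R) : (forall x y, P (x + y) = P x + P y) -> (forall x, `|P x| <= cn x) ->
    forall t, exists l, 0 < t -> (P (U n t) @[n --> \oo] --> l) /\
      forall n, `|l - P (U n t)| <= 2 * (B * expR (8^-1 * t)) * 2^-1 ^+ n.
  move=> PD Ple t; case: (ltP 0 t) => [t0|]; last by exists 0.
  have [|l hl] := @geometric_cauchy R (fun n => P (U n t)) (B * expR (8^-1 * t)).
    move=> n; rewrite US PD addrAC subrr add0r.
    apply: le_trans (Ple _) _; apply: le_trans ((hw n).2 _ t0) _.
    by rewrite mulrAC.
  by exists l.
have [ur hur] := choice (lim_ Re CReD norm_Re_le).
have [ui hui] := choice (lim_ Im CImD norm_Im_le).
pose u t : C := ur t +i* ui t.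
have hdiff n t : 0 < t -> cn (u t - U n t) <= 4 * B * 2^-1 ^+ n * expR (8^-1 * t).
  move=> t0; have [_ h1] := hur t t0; have [_ h2] := hui t t0.
  rewrite /cn CReB CImB; apply: le_trans (lerD (h1 n) (h2 n)) _.
  by rewrite le_eqVlt; apply/orP; left; apply/eqP; ring.
have mu : Cmeas u.
  split.
    apply: (@measurable_fun_cvg _ _ _ _ (fun n t => Re (U n t))).
    - by move=> n; have [B' [[]]] := hU n.
    - by move=> t; rewrite RposE => t0; have [] := hur t t0.
  apply: (@measurable_fun_cvg _ _ _ _ (fun n t => Im (U n t))).
  - by move=> n; have [B' [[]]] := hU n.
  - by move=> t; rewrite RposE => t0; have [] := hui t t0.
have hu : growth u (4 * B).
  split => // t t0; have := hdiff 0 t t0; rewrite expr0 mulr1.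
  by rewrite /U big_ord0 subr0.
have iu := growth_integ hu.
exists u, (4 * B); split => // t t0.
apply/eqP; rewrite -subr_eq0; apply/eqP/cn_eq0/eqP; rewrite eq_le cn_ge0 andbT.
pose E := expR (8^-1 * t).
(* The residual equals (u - U_(n+1)) - S (u - U_n). The contraction estimate bounds the second term,
   so no exchange of a limit with the integral is involved; the two halves add up to 4 B E 2^-n. *)
have hn n : cn (u t - opS u t - v t) <= 4 * B * E * 2^-1 ^+ n.
  have hd : growth (fun s => u s + (- 1) * U n s) (4 * B * 2^-1 ^+ n).
    split; first by apply: CmeasD => //; apply: CmeasM; [exact: Cmeas_cst|have [B' []] := hU n].
    by move=> s s0; rewrite mulN1r; exact: hdiff.
  have [_ /(_ _ t0)] := growth_opS hd.
  rewrite opS_add ?opS_scale//; last exact: CintegZ.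
  move=> h.
  have -> : u t - opS u t - v t = (u t - U n.+1 t) - (opS u t + -1 * opS (U n) t).
    by rewrite -SU//; ring.
  apply: le_trans (cnB _ _) _; apply: le_trans (lerD (hdiff n.+1 t t0) h) _.
  rewrite exprS -/E le_eqVlt; apply/orP; left; apply/eqP.
  by move: (2^-1 ^+ n) => q; field.
have c0 : 4 * B * E * 2^-1 ^+ n @[n --> \oo] --> (0 : R).
  rewrite -[X in _ --> X](mulr0 (4 * B * E)); apply: cvgMl_tmp.
  by apply: cvg_expr; rewrite ger0_norm//; lra.
by apply: (ler_cvg_to (cvg_cst _) c0); exact: nearW.
Qed.

End Decomposition.

(** The solution is psi + u with u - T u = T psi. Writing T = S + (finite rank), one looks for u =
    (1 - S)^-1 T psi + \sum_j x_j (1 - S)^-1 rank1_j; the equation holds once x_j is the j-th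
    truncated moment of u, a k by k linear system. *)
Lemma Fredholm : (forall phi, L2 phi -> L2_eq (opT phi) phi -> L2_eq phi (fun=> 0)) ->
  forall psi, L2 psi -> exists phi, L2 phi /\ forall t, 0 < t -> phi t - opT phi t = psi t.
Proof.
move=> noev psi hpsi.
pose M4 := I (fun s => expR (4^-1 * s)).
have M0 : 0 <= M4 by apply: Rint_ge0 => s _; exact: expR_ge0.
(* Chosen for A eta M4 <= 1/2; the added 1's keep the denominator positive. *)
pose eta := (2 * (A + 1) * (M4 + 1))^-1.
have A1 : 0 < A + 1 by rewrite ltr_wpDl.
have M1 : 0 < M4 + 1 by rewrite ltr_wpDl.
have eta0 : 0 < eta by rewrite invr_gt0 !mulr_gt0.
have hA : A * eta * M4 <= 2^-1.
  have -> : A * eta * M4 = (A * M4) / ((A + 1) * (M4 + 1)) * 2^-1.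
    by rewrite /eta; field; rewrite !gt_eqF.
  rewrite ler_piMl// ler_pdivrMr ?mulr_gt0// mul1r.
  by rewrite ler_pM// lerDl.
have [N [k hk]] := besselg_kernel_approx eta0.
have solve v B : growth v B -> exists u, (exists B', growth u B') /\
    forall t, 0 < t -> u t - opS N k u t = v t.
  by move=> /(Neumann hk hA)[u [B' [h1 h2]]]; exists u; split => //; exists B'.
have /choice[r hr] : forall j : 'I_k, exists u, (exists B', growth u B') /\
    forall t, 0 < t -> u t - opS N k u t = rank1 N j t.
  by move=> j; have [B hB] := growth_rank1 N j; exact: solve hB.
have ir j : Cinteg (r j) by have [[B' /growth_integ]] := hr j.
have ipsi := L2_integ hpsi.
have [rv [[Bv hrv] ev]] := solve _ _ (growth_opT ipsi).
have irv := growth_integ hrv.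
pose cmb (x : 'rV[C]_k) t := \sum_j x 0 j * r j t.
have gcmb (x : 'rV[C]_k) : exists B', growth (cmb x) B'.
  apply: (@growth_sum 'I_k (index_enum _) (fun j t => x 0 j * r j t)) => j.
  have [[B' h] _] := hr j.
  by exists (cn (x 0 j) * B'); exact: growth_scale.
have icmb (x : 'rV[C]_k) : Cinteg (cmb x) by have [B' /growth_integ] := gcmb x.
pose Mx : 'M[C]_k := \matrix_(i, j) trunc_moment N j (r i).
have coef_cmb (x : 'rV[C]_k) j : trunc_moment N j (cmb x) = (x *m Mx) 0 j.
  rewrite mxE /cmb trunc_moment_sum; last by move=> i; exact: CintegZ.
  by apply: eq_bigr => i _; rewrite mxE trunc_momentZ.
have S_cmb (x : 'rV[C]_k) t : 0 < t -> cmb x t - opS N k (cmb x) t = \sum_j x 0 j * rank1 N j t.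
  move=> t0; rewrite /cmb; elim: (index_enum _) => [|i s IH].
    have -> : (fun t => \sum_(j <- [::]) x 0 j * r j t) = (fun s => 0 * rv s).
      by apply/funext => s; rewrite big_nil mul0r.
    by rewrite opS_scale// mul0r !big_nil subr0.
  have -> : (fun t => \sum_(j <- i :: s) x 0 j * r j t) =
      (fun t => x 0 i * r i t + \sum_(j <- s) x 0 j * r j t).
    by apply/funext => t'; rewrite big_cons.
  have is_ : Cinteg (fun t => \sum_(j <- s) x 0 j * r j t).
    by apply: (Cint_sum s _).1 => j; exact: CintegZ.
  rewrite !big_cons opS_add//; last exact: CintegZ.
  rewrite opS_scale// opprD addrACA IH -mulrBr.
  by rewrite ((hr i).2 t t0).
(* For a row x with x Mx = x, the combination [cmb x] has moments x and is therefore fixed by T. The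
   absence of fixed points makes it vanish almost everywhere, and its moments, the entries of x, are
   then zero. *)
have unitM : (1%:M - Mx) \in unitmx.
  rewrite -row_free_unit -kermx_eq0; apply/rowV0P => x /sub_kermxP.
  rewrite mulmxBr mulmx1 => /eqP; rewrite subr_eq0 => /eqP xM.
  have cx j : trunc_moment N j (cmb x) = x 0 j by rewrite coef_cmb -xM.
  have Tx t : 0 < t -> opT (cmb x) t = cmb x t.
    move=> t0; apply/eqP; rewrite -subr_eq0; apply/eqP.
    have := S_cmb x t t0; rewrite /opS.
    under eq_bigr do rewrite cx.
    move: (\sum_j _) => q /eqP; rewrite subr_eq => /eqP ->.
    by rewrite [q + _]addrC subrK subrr.
  have [B' gx] := gcmb x.
  have x0 : L2_eq (cmb x) (fun=> 0).
    by apply: noev; [exact: growth_L2 gx|exact: L2_eq_ext].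
  apply/rowP => j; rewrite -cx mxE.
  rewrite (trunc_moment_ae (v := fun=> 0) N j gx.1 (Cmeas_cst 0) x0).
  by rewrite /trunc_moment (eq_Cint (G := fun=> 0)) ?Cint0// => s _; rewrite mulr0.
pose b : 'rV[C]_k := \row_j trunc_moment N j rv.
pose x := b *m invmx (1%:M - Mx).
have hx : x = b + x *m Mx.
  have : x *m (1%:M - Mx) = b by rewrite /x mulmxKV.
  by rewrite mulmxBr mulmx1 => <-; rewrite subrK.
pose u t := rv t + cmb x t.
have iu : Cinteg u by exact: CintegD.
(* The system x = b + x Mx says exactly this. *)
have cu j : trunc_moment N j u = x 0 j.
  by rewrite /u trunc_momentD// coef_cmb [in RHS]hx [RHS]mxE [b 0 j]mxE.
have Tu t : 0 < t -> u t - opT u t = opT psi t.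
  move=> t0; have := S_cmb x t t0; have := ev t t0.
  have : opS N k u t = opS N k rv t + opS N k (cmb x) t.
    by rewrite opS_add.
  rewrite {1}/opS; under eq_bigr do rewrite cu.
  move=> /eqP; rewrite subr_eq => /eqP -> <- <-.
  by rewrite /u; ring.
have [B' gx] := gcmb x.
exists (fun t => psi t + u t); split.
  by apply: L2_add => //; apply: L2_add; [exact: growth_L2 hrv|exact: growth_L2 gx].
move=> t t0; rewrite {1}/opT opKD// mulrDr -!/(opT _ _) -(Tu t t0).
by ring.
Qed.
End Fredholm.

(** * The transform B and the operator P *)

Section BorelTransform.
Context {R : realType}.
Local Notation C := R[i].
Local Notation D := (@Rpos R).
Local Notation m := (@m_meas R).
Local Notation mu := (@lebesgue_measure R).
Local Notation integ f := (m.-integrable D (EFin \o f)).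
Local Notation I f := (\int[m]_(t in D) f t)%R.
Local Notation Re := (@complex.Re R).
Local Notation Im := (@complex.Im R).
Implicit Types (p w x y z : C) (F G phi : R -> C) (s t : R).

Lemma CexpE p t : Cexp (- (t%:C * p)) = ec (Re p) (Im p) t +i* es (Re p) (Im p) t.
Proof.
apply: eq_ReIm; rewrite /Cexp ?CReCM ?CImCM /= ?CReN ?CImN ?CReCM ?CImCM /ec /es.
  by rewrite cosN (mulrC t) (mulrC t).
by rewrite sinN mulrN (mulrC t) (mulrC t).
Qed.

Lemma Cexp_addC (r : R) z : Cexp (r%:C + z) = (expR r)%:C * Cexp z.
Proof.
by rewrite /Cexp CReD CImD CReC CImC add0r expRD rmorphM mulrA.
Qed.

Lemma Cexp_real (r : R) : Cexp r%:C = (expR r)%:C.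
Proof.
by rewrite /Cexp CReC CImC cos0 sin0; apply: eq_ReIm;
  rewrite /= ?mulr1 ?mulr0 ?mul0r ?subr0 ?addr0.
Qed.

Lemma Cmeas_Cexp p : Cmeas (fun t => Cexp (- (t%:C * p))).
Proof.
apply: (@Cmeas_ext _ (fun t => ec (Re p) (Im p) t +i* es (Re p) (Im p) t)).
  by move=> t _; rewrite CexpE.
split => /=; apply: measurable_continuous => t.
  exact: continuous_is_derive (is_derive_ec _ _ t).
exact: continuous_is_derive (is_derive_es _ _ t).
Qed.

Lemma cn_Cexp_le p t : cn (Cexp (- (t%:C * p))) <= 2 * expR (- (Re p * t)).
Proof. by rewrite CexpE /cn/= mulr2n mulrDl mul1r lerD ?ec_le ?es_le. Qed.

Lemma measurable_expR_id : measurable_fun D (fun t : R => expR t).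
Proof.
have := @measurable_expR_lin R 1; apply: eq_measurable_fun => t _.
by rewrite mul1r.
Qed.

(** The kernel is of size e^((1 - Re (1/w)) t), and Re (1/w) > 1/2 puts it in L_2(m). *)
Lemma Cinteg_opB w phi : D1 w -> L2 phi ->
  Cinteg (fun t => Cexp (- (t%:C / w)) * (expR t)%:C * phi t).
Proof.
rewrite /D1/= => hw hp.
apply: (L2_Cinteg (K := 2) (c := 1 - Re w^-1)) hp.
- apply: CmeasM; first exact: Cmeas_Cexp.
  by apply: CmeasC; exact: measurable_expR_id.
- by lra.
- move=> t t0; rewrite mulrC cnCM ger0_norm ?expR_ge0//.
  apply: le_trans (ler_wpM2l (expR_ge0 _) (cn_Cexp_le _ _)) _.
  by rewrite mulrCA -expRD ler_wpM2l// ler_expR; lra.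
Qed.

Lemma opB_ext F G w : (forall t, 0 < t -> F t = G t) -> opB F w = opB G w.
Proof. by move=> h; congr (_ * _); apply: eq_Cint => t /h ->. Qed.

Lemma opBD F G w : D1 w -> L2 F -> L2 G ->
  opB (fun t => F t + G t) w = opB F w + opB G w.
Proof.
move=> hw hF hG; rewrite /opB -mulrDr -CintD; [|exact: Cinteg_opB..].
by congr (_ * _); apply: eq_Cint => t _; rewrite mulrDr.
Qed.

Lemma opBZ x F w : D1 w -> L2 F -> opB (fun t => x * F t) w = x * opB F w.
Proof.
move=> hw hF; rewrite /opB mulrCA -(CintZ x); last exact: Cinteg_opB.
by congr (_ * _); apply: eq_Cint => t _; rewrite [LHS]mulrCA.
Qed.

Lemma opBB F G w : D1 w -> L2 F -> L2 G ->
  opB (fun t => F t - G t) w = opB F w - opB G w.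
Proof.
move=> hw hF hG.
have -> : opB (fun t => F t - G t) w = opB (fun t => F t + (-1) * G t) w.
  by apply: opB_ext => t _; rewrite mulN1r.
by rewrite opBD//; [rewrite opBZ// mulN1r|exact: L2_scale].
Qed.

Lemma opB_ae F G w : D1 w -> L2 F -> L2 G -> L2_eq F G -> opB F w = opB G w.
Proof.
move=> hw hF hG FG; congr (_ * _); apply: Cint_ae.
- exact: Cinteg_meas (Cinteg_opB hw hF).
- exact: Cinteg_meas (Cinteg_opB hw hG).
- by apply: (@filterS _ _ (ae_filter_ringOfSetsType m)) FG => s h Ds; rewrite h.
Qed.

Lemma expR_sub1_density t : 0 < t -> (expR t - 1) * m_density t = t.
Proof.
by move=> t0; rewrite /m_density mulrC divfK// subr_eq0 gt_eqF// expR_gt1.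
Qed.

Lemma sqr_ReIm_gt0 p : p != 0 -> 0 < Re p ^+ 2 + Im p ^+ 2.
Proof.
move=> p0; rewrite lt_neqAle addr_ge0 ?sqr_ge0// andbT eq_sym.
apply: contra p0; rewrite paddr_eq0 ?sqr_ge0// !sqrf_eq0 => /andP[/eqP h1 /eqP h2].
by apply/eqP/eq_ReIm.
Qed.

Lemma Cinv p : p != 0 -> p^-1 =
  (Re p / (Re p ^+ 2 + Im p ^+ 2)) +i* (- Im p / (Re p ^+ 2 + Im p ^+ 2)).
Proof.
move=> p0; have n0 : Re p ^+ 2 + Im p ^+ 2 != 0 by rewrite gt_eqF// sqr_ReIm_gt0.
apply: (mulfI p0); rewrite mulfV// -[1]/((1 : R) +i* 0).
by apply: eq_ReIm; [rewrite CReM /=|rewrite CImM /=]; field.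
Qed.

Lemma Re_gt0_neq0 p : 0 < Re p -> p != 0.
Proof. by apply: contraTneq => ->; rewrite ltxx. Qed.

Lemma cn_inv p : p != 0 -> cn p^-1 <= 2 / cn p.
Proof.
move=> p0; have n0 := sqr_ReIm_gt0 p0.
have c0 : 0 < cn p.
  by rewrite lt_neqAle cn_ge0 andbT eq_sym; apply: contra p0 => /eqP /cn_eq0 ->.
rewrite ler_pdivlMr// (Cinv p0) /cn/= !normrM normrN !(gtr0_norm (_ : 0 < (_ + _)^-1)) ?invr_gt0//.
rewrite -mulrDl mulrAC ler_pdivrMr//.
rewrite -(real_normK (num_real (Re p))) -(real_normK (num_real (Im p))).
by have := sqr_ge0 (`|Re p| - `|Im p|); nra.
Qed.

Lemma CmeasV F : (forall t, 0 < t -> F t != 0) -> Cmeas F -> Cmeas (fun t => (F t)^-1).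
Proof.
move=> F0 [m1 m2].
(* The inverse of the squared modulus, written so that its measurability follows by composition. *)
pose n t := expR (- ln (Re (F t) ^+ 2 + Im (F t) ^+ 2)).
have nE t : 0 < t -> n t = (Re (F t) ^+ 2 + Im (F t) ^+ 2)^-1.
  by move=> /F0 /sqr_ReIm_gt0 h; rewrite /n expRN lnK.
have mn : measurable_fun D n.
  apply: measurableT_comp => //; apply: measurableT_comp => //.
  apply: measurableT_comp; first exact: measurable_ln.
  by apply: measurable_funD; exact: measurable_funX.
apply: (@Cmeas_ext _ (fun t => (Re (F t) * n t) +i* (- Im (F t) * n t))).
  by move=> t t0; rewrite nE// -Cinv// F0.
split => /=; apply: measurable_funM => //.
exact: measurableT_comp.
Qed.

Lemma Laplace_bessel p s : 0 < Re p -> 0 <= s ->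
  (laplace1 (ec (Re p) (Im p)) s +i* laplace1 (es (Re p) (Im p)) s) = p ^- 2 * Cexp (- (s%:C / p)).
Proof.
move=> p0 s0; have [h1 h2] := laplace_besselE (Im p) p0 s0.
rewrite CexpE -exprVn (Cinv (Re_gt0_neq0 p0)) expr2; apply: eq_ReIm => /=.
  rewrite h1 /ec /es; ring.
rewrite h2 /ec /es; ring.
Qed.

(** * Exchange of the kernel of B with K *)

Section Swap.
Variable a : R.
Hypothesis a2 : 1 / 2 < a.

(** The weight e^t (1 - e^(-t)) that the kernel of B and 1 - M produce together. It cancels the
    denominator of the density, so that [wf f] dm is t f(t) dt and K applied to [wf f] is a Laplace
    transform. *)
Let wf (f : R -> R) t := f t * (expR t - 1).

Let integ_wf (f : R -> R) : measurable_fun D f -> (forall t, `|f t| <= expR (- (a * t))) ->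
  integ (wf f).
Proof.
move=> mf hf; have a1 : 1 - a < 1 by have := a2; lra.
apply: integ_dom (integ_m_expR a1).
  apply: measurable_funM => //; apply: measurable_funB => //.
  exact: measurable_expR_id.
move=> t t0; rewrite /wf normrM.
have e1 : 1 <= expR t by rewrite -expR0 ler_expR ltW.
rewrite (@ger0_norm _ (expR t - 1)) ?subr_ge0//.
apply: (@le_trans _ _ (expR (- (a * t)) * expR t)).
  by rewrite ler_pM// ?subr_ge0// gerBl.
by rewrite -expRD ler_expR; lra.
Qed.

Let besselK_wf (f : R -> R) s : measurable_fun D f -> (forall t, `|f t| <= expR (- (a * t))) ->
  0 < s -> besselK (wf f) s = laplace1 f s.
Proof.
move=> mf hf s0; rewrite /besselK Rint_m; last by apply: integ_bessel => //; exact: integ_wf.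
apply: eq_Rint => t t0; rewrite /wf.
transitivity (besselg 1 (s * t) * f t * ((expR t - 1) * m_density t)).
  by rewrite (mulrC t s); ring.
by rewrite expR_sub1_density//; ring.
Qed.

Lemma Rint_swap_bessel (f u : R -> R) : measurable_fun D f -> (forall t, `|f t| <= expR (- (a * t))) ->
  integ u -> [/\ integ (fun t => wf f t * besselK u t), integ (fun s => u s * laplace1 f s) &
   I (fun t => wf f t * besselK u t) = I (fun s => u s * laplace1 f s)].
Proof.
move=> mf hf hu; have iw := integ_wf mf hf.
have hK (v : R -> R) : integ v -> integ (fun t => besselK v t * wf f t).
  move=> hv; apply: (integ_mulb (C := I (fun s => `|v s|)) iw).
    exact: measurable_besselK.
  by move=> t t0; exact: besselK_le.
have hL : integ (fun s => u s * laplace1 f s).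
  apply: (@integ_ext _ _ (fun s => besselK (wf f) s * u s)).
    by move=> s s0; rewrite besselK_wf// mulrC.
  apply: (integ_mulb (C := I (fun s => `|wf f s|)) hu).
    exact: measurable_besselK.
  by move=> t t0; exact: besselK_le.
split; [|exact: hL|].
  by apply: integ_ext (hK u hu) => t _; rewrite mulrC.
rewrite (besselK_sym iw hu); apply: eq_Rint => s s0.
by rewrite besselK_wf.
Qed.

End Swap.

(** K moves from phi to the exponential, where [Laplace_bessel] evaluates it; four real exchanges
    pair the components of e^(-pt) with those of phi. *)
Lemma Cint_swap_bessel p phi : 1 / 2 < Re p -> Cinteg phi ->
  Cintegral_m (fun t => Cexp (- (t%:C * p)) * (expR t - 1)%:C * opK phi t) =
  Cintegral_m (fun s => p ^- 2 * Cexp (- (s%:C / p)) * phi s).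
Proof.
move=> hp [iu iv].
have p0 : 0 < Re p by apply: lt_trans hp; lra.
set f := ec (Re p) (Im p); set g := es (Re p) (Im p).
have mf : measurable_fun D f.
  by apply: measurable_continuous => t; exact: continuous_is_derive (is_derive_ec _ _ t).
have mg : measurable_fun D g.
  by apply: measurable_continuous => t; exact: continuous_is_derive (is_derive_es _ _ t).
have hf t : `|f t| <= expR (- (Re p * t)) by exact: ec_le.
have hg t : `|g t| <= expR (- (Re p * t)) by exact: es_le.
have [a1 b1 e1] := Rint_swap_bessel hp mf hf iu.
have [a2 b2 e2] := Rint_swap_bessel hp mg hg iv.
have [a3 b3 e3] := Rint_swap_bessel hp mf hf iv.
have [a4 b4 e4] := Rint_swap_bessel hp mg hg iu.
have Rep (x y : R) : Re (x +i* y) = x by [].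
have Imp (x y : R) : Im (x +i* y) = y by [].
have ReI F : Re (Cintegral_m F) = I (fun t => Re (F t)) by [].
have ImI F : Im (Cintegral_m F) = I (fun t => Im (F t)) by [].
apply: eq_ReIm; rewrite ?ReI ?ImI.
  transitivity (I (fun t => f t * (expR t - 1) * besselK (Re \o phi) t -
                            g t * (expR t - 1) * besselK (Im \o phi) t)).
    apply: eq_Rint => t t0; rewrite (opK_ReIm _ t0) CexpE -/f -/g.
    move: (f t) (g t) (besselK _ t) (besselK (Im \o phi) t) => c d U V.
    by rewrite !(CReImE, Rep, Imp); ring.
  rewrite (RintB a1 a2) e1 e2 -(RintB b1 b2); apply: eq_Rint => s s0.
  rewrite -(Laplace_bessel p0 (ltW s0)) -/f -/g.
  move: (laplace1 f s) (laplace1 g s) => c d.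
  by rewrite !(CReImE, Rep, Imp); ring.
transitivity (I (fun t => f t * (expR t - 1) * besselK (Im \o phi) t +
                          g t * (expR t - 1) * besselK (Re \o phi) t)).
  apply: eq_Rint => t t0; rewrite (opK_ReIm _ t0) CexpE -/f -/g.
    move: (f t) (g t) (besselK _ t) (besselK (Im \o phi) t) => c d U V.
  by rewrite !(CReImE, Rep, Imp); ring.
rewrite (RintD a3 a4) e3 e4 -(RintD b3 b4); apply: eq_Rint => s s0.
rewrite -(Laplace_bessel p0 (ltW s0)) -/f -/g.
move: (laplace1 f s) (laplace1 g s) => c d.
by rewrite !(CReImE, Rep, Imp); ring.
Qed.

Lemma D1_Re w : D1 w -> 0 < Re w.
Proof.
rewrite /D1/= => h; have p0 : 0 < Re w^-1 by apply: lt_trans h; lra.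
have pn := Re_gt0_neq0 p0.
by rewrite -[w]invrK (Cinv pn)/= divr_gt0// sqr_ReIm_gt0.
Qed.

Lemma D1_neq0 w : D1 w -> w != 0.
Proof. by move=> /D1_Re; exact: Re_gt0_neq0. Qed.

Lemma D1_add1_neq0 w : D1 w -> w + 1 != 0.
Proof.
move=> /D1_Re h; apply/negP => /eqP e.
have : Re (w + 1) = 0 by rewrite e.
by rewrite CReD/=; lra.
Qed.

(** In the variable 1/w the two branches of P are 1/w -> 1 + 1/w and 1/w -> 1 + w, which shows that
    both preserve D_1. *)
Lemma inv_div_add1 w : D1 w -> (w / (w + 1))^-1 = 1 + w^-1.
Proof. by move=> h; rewrite invf_div mulrDl mul1r mulfV// D1_neq0. Qed.

Lemma D1_div_add1 w : D1 w -> D1 (w / (w + 1)).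
Proof. by move=> h; rewrite /D1/= inv_div_add1// CReD/=; move: h; rewrite /D1/=; lra. Qed.

Lemma D1_inv_add1 w : D1 w -> D1 (1 / (w + 1)).
Proof.
by move=> h; rewrite /D1/= [1 / (w + 1)]div1r invrK CReD/=; have := D1_Re h; lra.
Qed.

Definition opL phi t := opM phi t + (opK phi t - opM (opK phi) t).

Lemma cn_expRN_le (t : R) : 0 < t -> cn (expR (- t))%:C <= 1.
Proof. by move=> t0; rewrite cnC ger0_norm ?expR_ge0// -expR0 ler_expR oppr_le0 ltW. Qed.

Lemma Cmeas_expRN : Cmeas (fun t : R => (expR (- t))%:C).
Proof.
apply: CmeasC; have := @measurable_expRN R 1; apply: eq_measurable_fun => t _.
by rewrite mul1r.
Qed.

Lemma L2_opM phi : L2 phi -> L2 (opM phi).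
Proof. by apply: (L2_mul Cmeas_expRN); exact: cn_expRN_le. Qed.

Lemma L2_opK phi : L2 phi -> L2 (opK phi).
Proof.
move=> hp; apply: L2_ext (@L2_mul_opK _ (fun=> 1) 1 phi _ _ (L2_integ hp)).
- by move=> t _; rewrite mul1r.
- exact: Cmeas_cst.
- by move=> t _; rewrite cnC normr1.
Qed.

Lemma L2_opL phi : L2 phi -> L2 (opL phi).
Proof.
move=> hp; apply: L2_add; first exact: L2_opM.
by apply: L2_sub; [exact: L2_opK|apply: L2_opM; exact: L2_opK].
Qed.

(** In the first branch the kernel gains the factor e^(-t), which is M. In the second it becomes
    e^(-tw), that is e^(-t/p) for p = 1/w, which [Cint_swap_bessel] recognizes as coming from (1 -
    M) K. *)
Lemma opP_opB phi w : D1 w -> L2 phi -> opP (opB phi) w = opB (opL phi) w.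
Proof.
move=> hw hp; have w0 := D1_neq0 hw; have w1 := D1_add1_neq0 hw.
have hK := L2_opK hp.
rewrite opBD//; [|exact: L2_opM|by apply: L2_sub => //; exact: L2_opM].
rewrite /opP mulrDr; congr (_ + _).
  rewrite /opB mulrA; congr (_ * _).
    by field; rewrite w0 w1.
  apply: eq_Cint => t _; rewrite inv_div_add1// /opM mulrA; congr (_ * _).
  by rewrite mulrDr mulr1 opprD -rmorphN Cexp_addC; ring.
have EX t : Cexp (- (t%:C * (w + 1))) * (expR t)%:C = Cexp (- (t%:C * w)).
  rewrite mulrDr mulr1 opprD addrC -rmorphN Cexp_addC mulrAC -rmorphM -expRD.
  by rewrite addNr expR0 mul1r.
have w2 : 1 / (w + 1) = (w + 1)^-1 by rewrite div1r.
transitivity (Cintegral_m (fun s => Cexp (- (s%:C * w)) * phi s)).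
  rewrite /opB mulrA -[RHS]mul1r; congr (_ * _).
    by field; rewrite w1.
  by apply: eq_Cint => t _; rewrite w2 invrK EX.
rewrite /opB.
have E : Cintegral_m (fun t => Cexp (- (t%:C / w)) * (expR t)%:C * (opK phi t - opM (opK phi) t)) =
   Cintegral_m (fun t => Cexp (- (t%:C * w^-1)) * (expR t - 1)%:C * opK phi t).
  apply: eq_Cint => t _.
  have -> : (expR t - 1)%:C = (expR t)%:C * (1 - (expR (- t))%:C) :> C.
    by rewrite mulrBr mulr1 -rmorphM -expRD subrr expR0 rmorphB.
  by rewrite /opM; ring.
rewrite E Cint_swap_bessel//; last exact: L2_integ.
rewrite -CintZ; last first.
  have /(CintegZ (w ^+ 2)) := Cinteg_opB (D1_inv_add1 hw) hp.
  by apply: Cinteg_ext => t _; rewrite w2 invrK EX exprVn !invrK mulrA.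
apply: eq_Cint => s _; rewrite invrK; move: (Cexp _) (phi s) => e p.
by field; rewrite w0.
Qed.

End BorelTransform.

(** * Resolvents *)

Section Resolvent.
Context {R : realType}.
Local Notation C := R[i].
Local Notation D := (@Rpos R).
Local Notation m := (@m_meas R).
Local Notation mu := (@lebesgue_measure R).
Local Notation I f := (\int[m]_(t in D) f t)%R.
Local Notation Re := (@complex.Re R).
Local Notation Im := (@complex.Im R).
Implicit Types (w z lam : C) (f g : C -> C) (phi psi chi : R -> C) (s t : R).

Lemma integ_density (u : R -> R) : m.-integrable D (EFin \o u) ->
  mu.-integrable D (EFin \o (fun t => u t * m_density t)).
Proof.
move=> /[dup] hu /integrableP[_ h]; have mu_ := integ_meas hu.
apply/integrableP; split.
  by apply/measurable_EFinP; apply: measurable_funM => //; exact: measurable_density.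
apply: le_lt_trans h.
have -> : (\int[m]_(t in D) `|(EFin \o u) t| = \int[m]_(t in D) (`|u t|)%:E)%E by [].
rewrite integral_m_ge0//; last exact: measurableT_comp.
rewrite le_eqVlt; apply/orP; left; apply/eqP; apply: eq_integral => t /[!inE].
by rewrite RposE => t0 /=; rewrite normrM (ger0_norm (m_density_pos t0)).
Qed.

(** [Lerch] is applied to u times the density. The density is positive on the half-line and can be
    divided out; Lebesgue null sets are m-null. *)
Lemma Lerch_m (u : R -> R) : m.-integrable D (EFin \o u) ->
  (forall n : nat, I (fun t => expR (- (n%:R * t)) * u t) = 0) ->
  {ae m, forall t, D t -> u t = 0}.
Proof.
move=> hu h0; have iu := integ_density hu.
have := Lerch iu; case.
  move=> n; rewrite -(h0 n) Rint_m.
    by apply: eq_Rint => t _; rewrite mulrA.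
  apply: (integ_mulb (C := 1) hu); first exact: measurable_expRN.
  move=> t t0; have /andP[h1 h2] := @expRN_in01 _ (n%:R * t) (mulr_ge0 (ler0n _ _) (ltW t0)).
  by rewrite ger0_norm.
move=> A [mA A0 hA]; exists A; split => //.
  by move/null_content_dominatesP : (@m_meas_dominates R); apply.
move=> t /= ht; apply: hA => /= h; apply: ht => Dt; have /eqP := h Dt.
rewrite mulf_eq0 => /orP[/eqP//|]; rewrite gt_eqF//.
by move: Dt; rewrite RposE => t0; rewrite /m_density divr_gt0// subr_gt0 expR_gt1.
Qed.

Lemma opB_inj phi psi : L2 phi -> L2 psi -> D1_eq (opB phi) (opB psi) -> L2_eq phi psi.
Proof.
move=> hphi hpsi h; pose chi t := phi t - psi t.
have hchi : L2 chi by exact: L2_sub.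
have ichi := L2_integ hchi.
(* At w = 1/(n+1), a point of D_1, the kernel of B is e^(-nt) up to the factor (n+1)^2. *)
have hn (n : nat) : Cintegral_m (fun t => (expR (- (n%:R * t)))%:C * chi t) = 0.
  pose p : R := 1 + n%:R; have p0 : 0 < p by rewrite ltr_pwDl.
  pose w : C := (p^-1)%:C; have wE : w^-1 = p%:C by rewrite /w fmorphV invrK.
  have hw : D1 w.
    suff : 1 / 2 < Re w^-1 by [].
    by rewrite wE /p CReC; have : (0 : R) <= n%:R := ler0n _ _; lra.
  have : opB chi w = 0 by rewrite opBB// h// subrr.
  move/eqP; rewrite mulf_eq0 invr_eq0 expf_eq0/= (negPf (D1_neq0 hw))/= => /eqP <-.
  apply: eq_Cint => t _; rewrite wE -rmorphM -rmorphN Cexp_real -rmorphM -expRD.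
  by congr ((expR _)%:C * _); rewrite /p; ring.
have ae1 : {ae m, forall t, D t -> Re (chi t) = 0}.
  apply: Lerch_m; first by case: ichi.
  move=> n; have : Re (Cintegral_m (fun t => (expR (- (n%:R * t)))%:C * chi t)) = 0 by rewrite hn.
  by move=> <-; apply: eq_Rint => t _; rewrite CReCM.
have ae2 : {ae m, forall t, D t -> Im (chi t) = 0}.
  apply: Lerch_m; first by case: ichi.
  move=> n; have : Im (Cintegral_m (fun t => (expR (- (n%:R * t)))%:C * chi t)) = 0 by rewrite hn.
  by move=> <-; apply: eq_Rint => t _; rewrite CImCM.
apply: (@filterS2 _ _ (ae_filter_ringOfSetsType m)) ae1 ae2 => t h1 h2 Dt.
apply/eqP; rewrite -subr_eq0; apply/eqP/eq_ReIm; [exact: h1|exact: h2].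
Qed.

(** As e^(-t) stays in [0, 1], this bounds the multiplier (lam - e^(-t))^-1, hence also that of
    K_(1/lam). *)
Lemma cn_sub_segment_ge lam : ~ (exists2 r : R, 0 <= r <= 1 & lam = r%:C) ->
  exists2 d : R, 0 < d & forall x : R, 0 <= x <= 1 -> d <= cn (lam - x%:C).
Proof.
move=> hl; have [im0|im0] := eqVneq (Im lam) 0; last first.
  exists `|Im lam|; first by rewrite normr_gt0.
  by move=> x _; rewrite /cn CImB CImC subr0 lerDr.
have [re0|re0] := ltP (Re lam) 0.
  exists (- Re lam); first by rewrite oppr_gt0.
  move=> x /andP[x0 _]; apply: le_trans (norm_Re_le _); rewrite CReB CReC.
  by rewrite ltr0_norm; lra.
have [re1|re1] := leP (Re lam) 1.
  by exfalso; apply: hl; exists (Re lam); [rewrite re0|exact: eq_ReIm].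
exists (Re lam - 1); first by rewrite subr_gt0.
move=> x /andP[_ x1]; apply: le_trans (norm_Re_le _); rewrite CReB CReC.
by rewrite ger0_norm; lra.
Qed.

Section FixedLambda.
Variable lam : C.
Hypothesis hlam : ~ (exists2 r : R, 0 <= r <= 1 & lam = r%:C).

Let e t : C := (expR (- t))%:C.

Lemma lam_neq0 : lam != 0.
Proof.
apply/negP => /eqP l0; apply: hlam; exists 0; first by rewrite lexx ler01.
by rewrite l0.
Qed.

Lemma lam_e t : 0 < t -> lam - e t != 0.
Proof.
move=> t0; have [d d0 /(_ (expR (- t))) h] := cn_sub_segment_ge hlam.
have : d <= cn (lam - e t) by apply: h; apply: expRN_in01; exact: ltW.
by apply: contraTneq => ->; rewrite cn0 -ltNge.
Qed.

Let cn_inv_lam_e : exists A, forall t, 0 < t -> cn (lam - e t)^-1 <= A.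
Proof.
have [d d0 h] := cn_sub_segment_ge hlam; exists (2 / d) => t t0.
apply: le_trans (cn_inv (lam_e t0)) _; rewrite ler_wpM2l//.
have dc : d <= cn (lam - e t) by apply: h; apply: expRN_in01; exact: ltW.
by rewrite lef_pV2 ?posrE// (lt_le_trans d0).
Qed.

Let Cmeas_lam_e : Cmeas (fun t => lam - e t).
Proof. by apply: CmeasB; [exact: Cmeas_cst|exact: Cmeas_expRN]. Qed.

Let a t : C := lam^-1 * (1 - e t) / (1 - lam^-1 * e t).

Let aE t : 0 < t -> a t = (1 - e t) * (lam - e t)^-1.
Proof.
move=> t0; have h := lam_e t0; rewrite /a; field.
by rewrite lam_neq0 h.
Qed.

Let Cmeas_a : Cmeas a.
Proof.
apply: (@Cmeas_ext _ (fun t => (1 - e t) * (lam - e t)^-1)).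
  by move=> t t0; rewrite aE.
apply: CmeasM; first by apply: CmeasB; [exact: Cmeas_cst|exact: Cmeas_expRN].
by apply: CmeasV; [exact: lam_e|exact: Cmeas_lam_e].
Qed.

Let cn_a : exists A, forall t, 0 < t -> cn (a t) <= A.
Proof.
have [A hA] := cn_inv_lam_e; exists (2 * A) => t t0; rewrite aE//.
apply: le_trans (cnM _ _) _; apply: ler_pM; rewrite ?cn_ge0 ?hA//.
apply: le_trans (cnB _ _) _; have := cn_expRN_le t0.
by rewrite -/(e t) (cnC 1) normr1; lra.
Qed.

Lemma invertible_lam_opM :
  op_invertible (@L2 R) (@L2_eq R) (op_scalar_minus lam (@opM R)).
Proof.
have TE phi t : op_scalar_minus lam (@opM R) phi t = (lam - e t) * phi t.
  by rewrite /op_scalar_minus /opM mulrBl.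
have [A hA] := cn_inv_lam_e.
split.
- by move=> phi hphi; apply: L2_sub; [exact: L2_scale|exact: L2_opM].
- move=> phi psi _ _; split => h.
    apply: (@filterS _ _ (ae_filter_ringOfSetsType m)) h => t h Dt.
    by rewrite !TE h.
  apply: (@filterS _ _ (ae_filter_ringOfSetsType m)) h => t h Dt.
  move: (h Dt); rewrite !TE; apply: mulfI; apply: lam_e.
  by move: Dt; rewrite RposE.
move=> psi hpsi; exists (fun t => (lam - e t)^-1 * psi t).
  by apply: (L2_mul _ hA hpsi); apply: CmeasV; [exact: lam_e|exact: Cmeas_lam_e].
apply: L2_eq_ext => t t0; rewrite TE mulrA mulfV ?mul1r//.
exact: lam_e.
Qed.

Let L2_opKz phi : L2 phi -> L2 (opKz lam^-1 phi).
Proof.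
have [A hA] := cn_a.
by move=> /L2_integ hp; exact: (L2_mul_opK Cmeas_a hA).
Qed.

Hypothesis hev : ~ op_eigenvalue (@L2 R) (@L2_eq R) (opKz lam^-1) 1.

Let noev phi : L2 phi -> L2_eq (opKz lam^-1 phi) phi -> L2_eq phi (fun=> 0).
Proof.
move=> hp h; apply: contrapT => h0; apply: hev; exists phi; split => //.
by apply: L2_eq_trans h _; apply: L2_eq_ext => t _; rewrite mul1r.
Qed.

Lemma invertible_1_opKz :
  op_invertible (@L2 R) (@L2_eq R) (op_scalar_minus 1 (opKz lam^-1)).
Proof.
split.
- by move=> phi hphi; apply: L2_sub; [exact: L2_scale|exact: L2_opKz].
- move=> phi psi hphi hpsi; split => h.
    apply: (@filterS _ _ (ae_filter_ringOfSetsType m)) (h) => t ht Dt.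
    have t0 : 0 < t by move: Dt; rewrite RposE.
    rewrite /op_scalar_minus ht// /opKz.
    by rewrite (opK_ae t0 (L2_meas hphi) (L2_meas hpsi) h).
  have hsub := L2_sub hphi hpsi.
  have /(noev hsub) : L2_eq (opKz lam^-1 (fun t => phi t - psi t)) (fun t => phi t - psi t).
    apply: (@filterS _ _ (ae_filter_ringOfSetsType m)) h => t ht Dt.
    have t0 : 0 < t by move: Dt; rewrite RposE.
    move: (ht Dt); rewrite /op_scalar_minus !mul1r => e1.
    rewrite /opKz opKB//; [|exact: L2_integ..].
    rewrite mulrBr -!/(opKz _ _ t).
    transitivity (phi t - psi t - ((phi t - opKz lam^-1 phi t) - (psi t - opKz lam^-1 psi t))).
      by ring.
    by rewrite e1 subrr subr0.
  apply: (@filterS _ _ (ae_filter_ringOfSetsType m)) => t ht Dt.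
  by apply/eqP; rewrite -subr_eq0; apply/eqP; exact: ht.
have [A hA] := cn_a.
move=> psi /(Fredholm Cmeas_a hA noev)[phi [hphi e1]]; exists phi => //.
by apply: L2_eq_ext => t t0; rewrite /op_scalar_minus mul1r -(e1 _ t0).
Qed.
End FixedLambda.
End Resolvent.

(** * Transfer of the resolvent from L_2(m) to H_0 *)

Section ResolventOfTransfer.
Context {R : realType}.
Local Notation C := R[i].
Local Notation m := (@m_meas R).
Implicit Types (w z : C) (f g : C -> C) (phi psi : R -> C) (t : R).

Lemma op_inverseP (U : Type) (S : (U -> C) -> Prop) (E : (U -> C) -> (U -> C) -> Prop)
    (T : (U -> C) -> U -> C) (g : U -> C) : op_invertible S E T -> S g ->
  S (op_inverse S E T g) /\ E (T (op_inverse S E T g)) g.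
Proof.
move=> [_ _ surj] /surj[f Sf Ef].
by apply: (xgetPex (fun=> 0) (P := [set f | S f /\ E (T f) g])); exists f.
Qed.

Lemma opP_D1_eq f g : D1_eq f g -> D1_eq (opP f) (opP g).
Proof. by move=> h w hw; rewrite /opP !h//; [exact: D1_inv_add1|exact: D1_div_add1]. Qed.

Lemma D1_eq_sym f g : D1_eq f g -> D1_eq g f.
Proof. by move=> h w hw; rewrite h. Qed.

Lemma D1_eq_trans f g h : D1_eq f g -> D1_eq g h -> D1_eq f h.
Proof. by move=> h1 h2 w hw; rewrite h1// h2. Qed.

Variable lam : C.
Hypothesis hlam : ~ (exists2 r : R, 0 <= r <= 1 & lam = r%:C).
Hypothesis hev : ~ op_eigenvalue (@L2 R) (@L2_eq R) (opKz lam^-1) 1.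

Local Notation lamM := (op_scalar_minus lam (@opM R)).
Local Notation oneK := (op_scalar_minus 1 (opKz lam^-1)).
Local Notation lamP := (op_scalar_minus lam (@opP R)).

Let invM : op_invertible (@L2 R) (@L2_eq R) lamM := invertible_lam_opM hlam.
Let invK : op_invertible (@L2 R) (@L2_eq R) oneK := invertible_1_opKz hlam hev.

Lemma lamP_opB f phi : L2 phi -> D1_eq f (opB phi) -> D1_eq (lamP f) (opB (lamM (oneK phi))).
Proof.
move=> hp hf w hw; rewrite /op_scalar_minus (opP_D1_eq hf hw) (hf w hw) opP_opB//.
rewrite -(opBZ lam hw hp) -(opBB hw (L2_scale lam hp) (L2_opL hp)).
apply: opB_ext => t t0.
rewrite /opL /opM /opKz mul1r.
have h := lam_e hlam t0; have l0 := lam_neq0 hlam.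
move: (phi t) (opK phi t) h => p k; move: ((expR (- t))%:C) => e h.
by field; rewrite l0 h.
Qed.

(** B intertwines lam - P with a product of two invertible operators of L_2(m). Its injectivity is
    what turns an equality on D_1 back into one in L_2(m). *)
Lemma invertible_lam_opP : op_invertible (@calH0 R) (@D1_eq R) lamP.
Proof.
have [M1 M2 M3] := invM; have [K1 K2 K3] := invK.
split.
- move=> f [phi hp hf]; exists (lamM (oneK phi)); first exact/M1/K1.
  exact: lamP_opB.
- move=> f g [phi hp hf] [psi hq hg]; split => h.
    by move=> w hw; rewrite /op_scalar_minus (h w hw) (opP_D1_eq h hw).
  have : D1_eq (opB (lamM (oneK phi))) (opB (lamM (oneK psi))).
    apply: D1_eq_trans (D1_eq_sym (lamP_opB hp hf)) _.
    exact: D1_eq_trans h (lamP_opB hq hg).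
  move/(opB_inj (M1 _ (K1 _ hp)) (M1 _ (K1 _ hq))).
  move/(M2 _ _ (K1 _ hp) (K1 _ hq))/(K2 _ _ hp hq) => e w hw.
  by rewrite hf// hg//; exact: opB_ae.
move=> g [psi hq hg]; have [chi hc ec] := M3 _ hq; have [phi hp ep] := K3 _ hc.
exists (opB phi); first by exists phi.
apply: D1_eq_trans (lamP_opB hp _) _; first by [].
move=> w hw; rewrite hg//; apply: opB_ae => //; first exact/M1/K1.
by apply: L2_eq_trans ec; apply/(M2 _ _ (K1 _ hp) hc).
Qed.

(** [op_inverse] is an arbitrary choice among representatives, so both sides are compared after
    applying lam - P, which is injective on H_0. *)
Lemma resolvent_opB f phi : L2 phi -> D1_eq f (opB phi) ->
  D1_eq (op_inverse (@calH0 R) (@D1_eq R) lamP f)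
    (opB (op_inverse (@L2 R) (@L2_eq R) oneK (op_inverse (@L2 R) (@L2_eq R) lamM phi))).
Proof.
move=> hp hf; have [M1 M2 _] := invM; have [K1 _ _] := invK.
have [hchi echi] := op_inverseP invM hp.
have [heta eeta] := op_inverseP invK hchi.
set eta := op_inverse _ _ oneK _ in heta eeta *.
have Sf : calH0 f by exists phi.
have [hg eg] := op_inverseP invertible_lam_opP Sf.
have [_ P2 _] := invertible_lam_opP.
have Seta : calH0 (opB eta) by exists eta.
apply/(P2 _ _ hg Seta); apply: D1_eq_trans eg _.
apply: D1_eq_trans hf _; apply: D1_eq_sym.
apply: D1_eq_trans (lamP_opB heta _) _; first by [].
move=> w hw; apply: opB_ae => //; first exact/M1/K1.
by apply: L2_eq_trans echi; apply/(M2 _ _ (K1 _ heta) hchi).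
Qed.

End ResolventOfTransfer.

Theorem theorem2 (R : realType) (f : R[i] -> R[i]) (phi : R -> R[i])
    (Hphi : L2 phi) (Hf : D1_eq f (opB phi)) :
  [/\ L2 (opM phi \+ (opK phi \- opM (opK phi))),
      D1_eq (opP f) (opB (opM phi \+ (opK phi \- opM (opK phi)))) &
      forall lam : R[i],
        ~ (exists2 r : R, 0 <= r <= 1 & lam = r%:C) ->
        ~ op_eigenvalue (@L2 R) (@L2_eq R) (opKz lam^-1) 1 ->
        [/\ op_invertible (@L2 R) (@L2_eq R) (op_scalar_minus lam (@opM R)),
            op_invertible (@L2 R) (@L2_eq R) (op_scalar_minus 1 (opKz lam^-1)),
            op_invertible (@calH0 R) (@D1_eq R) (op_scalar_minus lam (@opP R)) &
            D1_eq
              (op_inverse (@calH0 R) (@D1_eq R) (op_scalar_minus lam (@opP R)) f)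
              (opB (op_inverse (@L2 R) (@L2_eq R) (op_scalar_minus 1 (opKz lam^-1))
                   (op_inverse (@L2 R) (@L2_eq R) (op_scalar_minus lam (@opM R))
                      phi)))]].
Proof.
split.
- exact: L2_opL.
- move=> w hw; rewrite (opP_D1_eq Hf hw); exact: opP_opB.
move=> lam hlam hev; split.
- exact: invertible_lam_opM.
- exact: invertible_1_opKz.
- exact: invertible_lam_opP.
- exact: resolvent_opB.
Qed.
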